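(* Let $H$ be a division ring of finite dimension over its centre $h$ and let $\alpha:G\to\mathrm{Gal}(L/H)$ be a finite embedding problem over $H$. The maps $\beta\mapsto\check{\beta}$ and $\gamma\mapsto\hat{\gamma}$ are mutually inverse bijections between the set of solutions $\beta$ to $\alpha$ and the set of solutions $\gamma:\mathrm{Gal}(f/h)\to G$ to $\check{\alpha}$ such that $\mathcal{F}_H$ has only the trivial zero over $f$.
   Context: A division ring is a nonzero (not necessarily commutative) ring in which every nonzero element is invertible; a field is a commutative division ring. An extension $L/H$ of division rings means that $H$ is a subring of $L$. $\mathrm{Aut}(L/H)$ is the group of automorphisms of $L$ fixing $H$ pointwise. $L/H$ is Galois (in the sense of Artin) if every element of $L$ fixed by all of $\mathrm{Aut}(L/H)$ lies in $H$; then $\mathrm{Gal}(L/H)=\mathrm{Aut}(L/H)$. Reduced norm form: let $[H:h]=n^2$, let $d \supseteq h$ be a splitting field of $H$ with an isomorphism of $d$-algebras $\phi : H\otimes_h d \to \mathcal{M}_n(d)$, and put $\mathrm{Nrd}_{H/h}(x)=\det(\phi(x\otimes 1))$, which lies in $h$ and is independent of $d$ and $\phi$. For a fixed $h$-basis $e_1,\dots,e_{n^2}$ of $H$, $\mathcal{F}_H(x_1,\dots,x_{n^2}) = \mathrm{Nrd}_{H/h}(x_1e_1+\cdots+x_{n^2}e_{n^2})$, viewed as a polynomial in $h[x_1,\dots,x_{n^2}]$. It has only the trivial zero over a field $f\supseteq h$ if for $a\in f^{n^2}$, $\mathcal{F}_H(a)=0$ implies $a=0$. Known facts ($H$ finite-dimensional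 over its centre $h$). If $F/H$ is Galois with finite group and $f$ is the centre of $F$, then $h\subseteq f$, $f/h$ is finite Galois, $\mathcal{F}_H$ has only the trivial zero over $f$, the multiplication map $H\otimes_hf\to F$ is an isomorphism (and one identifies $F$ with $H\otimes_h f$ through it), and restriction $\mathrm{res}^{F/H}_{f/h}:\mathrm{Gal}(F/H)\to\mathrm{Gal}(f/h)$ is a well-defined isomorphism. Conversely, if $f/h$ is a finite Galois extension of fields over which $\mathcal{F}_H$ has only the trivial zero, then $H\otimes_hf$ is a division ring with centre $f$ (identified with $1\otimes f$), $(H\otimes_hf)/H$ is Galois, and $\mathrm{res}^{(H\otimes_hf)/H}_{f/h}$ is a well-defined isomorphism. If $L\subseteq F$ with $L/H$, $F/H$ Galois with finite groups, restriction $\mathrm{res}^{F/H}_{L/H}$ is well defined. Let $K$ be a division ring finite-dimensional over its centre (possibly a field). A finite embedding problem over $K$ is an epimorphism $\alpha:G\to\mathrm{Gal}(L/K)$ with $G$ a finite group and $L/K$ Galois. A solution to $\alpha$ is an isomorphism $\beta:\mathrm{Gal}(F/K)\to G$, where $F/K$ is Galois with $L\subseteq F$, such that $\alpha\circ\beta=\mathrm{res}^{F/K}_{L/K}$. Notation: for $\alpha:G\to\mathrm{Gal}(L/H)$ with $\ell$ the centre of $L$, $\check{\alpha}=\mathrm{res}^{L/H}_{\ell/h}\circ\alpha:G\to\mathrm{Gal}(\ell/h)$. For a solution $\beta:\mathrm{Gal}(F/H)\to G$ to $\alpha$, with $f$ the centre of $F$, $\check{\beta}=\beta\circ(\mathrm{res}^{F/H}_{f/h})^{-1}:\mathrm{Gal}(f/h)\to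 G$. For a solution $\gamma:\mathrm{Gal}(f/h)\to G$ to $\check{\alpha}$ such that $\mathcal{F}_H$ has only the trivial zero over $f$, $\hat{\gamma}=\gamma\circ\mathrm{res}^{(H\otimes_hf)/H}_{f/h}:\mathrm{Gal}((H\otimes_hf)/H)\to G$ (where $L=H\otimes_h\ell\subseteq H\otimes_hf$). *)

(* Defs.v *)
From HB Require Import structures.
From mathcomp Require Import all_boot all_algebra all_fingroup.
From mathcomp Require Import boolp classical_sets.
From mathcomp.multinomials Require Import mpoly.
From mathcomp Require Import generic_quotient.
Set Implicit Arguments.
Unset Strict Implicit.
Unset Printing Implicit Defensive.

Import GRing.Theory.
Local Open Scope ring_scope.
Local Open Scope quotient_scope.

(* Rings are (possibly noncommutative) pzRingTypes.  A field is a commutative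
   division ring: a comPzRingType satisfying division_ring. *)
Definition division_ring (R : pzRingType) : Prop :=
  (1 : R) != 0 /\
  forall x : R, x != 0 -> exists y : R, x * y = 1 /\ y * x = 1.

Definition ring_morphism (R S : pzRingType) (f : R -> S) : Prop :=
  Algebra.zmod_morphism f /\ GRing.monoid_morphism f.

(* The element x with f x = y; the default d is only used if there is none. *)
Definition inverse_fun (A : choiceType) (B : Type) (d : A) (f : A -> B) : B -> A :=
  fun y => xget d [set x | f x = y]%classic.

Section Centre.
Variable R : pzRingType.

Definition central : {pred R} := fun x => `[< forall y, x * y = y * x >].

Lemma centralP x : reflect (forall y, x * y = y * x) (x \in central).
Proof. exact: asboolP. Qed.

Fact central_subring : GRing.subring_closed central.
Proof.
split.
- by apply/centralP => y; rewrite mul1r mulr1.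
- move=> x y /centralP cx /centralP cy; apply/centralP => z.
  by rewrite mulrBl mulrBr cx cy.
- move=> x y /centralP cx /centralP cy; apply/centralP => z.
  by rewrite -mulrA cy mulrA cx mulrA.
Qed.

Record centre := Centre { centre_val : R; _ : centre_val \in central }.

HB.instance Definition _ := [isSub for centre_val].
HB.instance Definition _ := [Choice of centre by <:].
HB.instance Definition _ :=
  GRing.SubChoice_isSubPzRing.Build R central centre central_subring.

Fact centre_mulC : commutative (@GRing.mul centre).
Proof. by move=> x y; apply/val_inj => /=; case: x => x /= /centralP ->. Qed.

HB.instance Definition _ :=
  GRing.PzSemiRing_hasCommutativeMul.Build centre centre_mulC.

End Centre.

Fact centre_oner_neq0 (R : nzRingType) : (1 : centre R) != 0.
Proof. by rewrite -val_eqE /= oner_neq0. Qed.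

HB.instance Definition _ (R : nzRingType) :=
  GRing.PzSemiRing_isNonZero.Build (centre R) (centre_oner_neq0 R).

(* For an extension j : K -> L such that Z(K) is contained in Z(L), this is the
   inclusion Z(K) -> Z(L); elements whose image is not central are sent to 0. *)
Definition centre_map (K L : pzRingType) (j : K -> L) : centre K -> centre L :=
  fun c => insubd 0 (j (val c)).

(* Given an embedding j : K -> L, gal j is the group Aut(L/K), with
   (s * t) x = s (t x). *)
Section GaloisGroup.
Variables (K L : pzRingType) (j : K -> L).

Record gal := Gal {
  gal_val :> L -> L;
  gal_morph : ring_morphism gal_val;
  gal_bij : bijective gal_val;
  gal_fix : forall x, gal_val (j x) = j x
}.

Lemma galP (s t : gal) : s =1 t -> s = t.
Proof.
case: s t => s s1 s2 s3 [t t1 t2 t3] /= /funext st.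
by case: t / st t1 t2 t3 => *; congr Gal; exact: Prop_irrelevance.
Qed.

HB.instance Definition _ := gen_eqMixin gal.
HB.instance Definition _ := gen_choiceMixin gal.

Fact gal_one_morph : ring_morphism (@id L).
Proof. by []. Qed.

Definition gal_one := Gal gal_one_morph (Bijective (frefl id) (frefl id))
  (fun x => erefl (j x)).

Fact gal_mul_morph (s t : gal) : ring_morphism (s \o t).
Proof.
case: s t => s [sB [s1 sM]] ? ? [t [tB [t1 tM]] ? ?] /=.
by split; [move=> x y /=; rewrite tB sB|split=> [|x y] /=; rewrite ?t1 ?tM].
Qed.

Fact gal_mul_fix (s t : gal) x : (s \o t) (j x) = j x.
Proof. by rewrite /= !gal_fix. Qed.

Definition gal_mul (s t : gal) :=
  Gal (gal_mul_morph s t) (bij_comp (gal_bij s) (gal_bij t)) (gal_mul_fix s t).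

Fact gal_inv_ex (s : gal) : exists t : gal, cancel s t /\ cancel t s.
Proof.
case: s => s [sB [s1 sM]] [t st ts] sf; have sI := can_inj st.
have tm : ring_morphism t.
  by split; [move=> x y|split=> [|x y]]; apply: sI; rewrite ?sB ?sM ?ts.
have tf x : t (j x) = j x by apply: sI; rewrite ts sf.
by exists (Gal tm (Bijective ts st) tf).
Qed.

Definition gal_inv (s : gal) : gal := projT1 (cid (gal_inv_ex s)).

Fact gal_mulA : associative gal_mul.
Proof. by move=> s t u; apply: galP. Qed.
Fact gal_mul1 : left_id gal_one gal_mul.
Proof. by move=> s; apply: galP. Qed.
Fact gal_1mul : right_id gal_one gal_mul.
Proof. by move=> s; apply: galP. Qed.
Fact gal_mulV : left_inverse gal_one gal_inv gal_mul.
Proof. by move=> s; apply: galP; case: (projT2 (cid (gal_inv_ex s))). Qed.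
Fact gal_mulVr : right_inverse gal_one gal_inv gal_mul.
Proof. by move=> s; apply: galP; case: (projT2 (cid (gal_inv_ex s))). Qed.

HB.instance Definition _ :=
  isGroup.Build gal gal_mulA gal_mul1 gal_1mul gal_mulV gal_mulVr.

Definition galois : Prop :=
  forall x : L, (forall s : gal, s x = x) -> exists y : K, x = j y.

End GaloisGroup.

(* Restriction to L of the automorphisms of F, along u : L -> F.  The function
   res is total: it takes the value 1 on those automorphisms of F that
   do not restrict to an element of Aut(L/K). *)
Section Restriction.
Variables (K L K' F : pzRingType) (jL : K -> L) (jF : K' -> F) (u : L -> F).

Definition restricts (s : gal jF) (t : gal jL) : Prop :=
  forall x, s (u x) = u (t x).

Definition res (s : gal jF) : gal jL :=
  xget (1%g : gal jL) [set t | restricts s t]%classic.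

End Restriction.

Arguments res {K L K' F jL jF} u s.

(* The tensor product of a ring H and a commutative ring f over the centre h of
   H, for k : h -> f: the quotient of the formal sums of pairs (x, a),
   represented as lists, by the congruence generated by the bilinearity
   relations and (x c, a) = (x, k c a) for c in h. *)
Section Tensor.
Variables (H : pzRingType) (f : comPzRingType) (k : centre H -> f).

Inductive tens_rel : seq (H * f) -> seq (H * f) -> Prop :=
| TensRefl s : tens_rel s s
| TensSym s t : tens_rel s t -> tens_rel t s
| TensTrans s t u : tens_rel s t -> tens_rel t u -> tens_rel s u
| TensCat s s' t t' :
    tens_rel s s' -> tens_rel t t' -> tens_rel (s ++ t) (s' ++ t')
| TensCatC s t : tens_rel (s ++ t) (t ++ s)
| Tens0 a : tens_rel [:: (0, a)] [::]
| TensDl x y a : tens_rel [:: (x + y, a)] [:: (x, a); (y, a)]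
| TensDr x a b : tens_rel [:: (x, a + b)] [:: (x, a); (x, b)]
| TensBal x c a : tens_rel [:: (x * val c, a)] [:: (x, k c * a)].

Definition tens_relb (s t : seq (H * f)) : bool := `[< tens_rel s t >].

Fact tens_relb_equiv : equiv_class_of tens_relb.
Proof.
split=> [s|s t|t s u].
- exact/asboolP/TensRefl.
- by apply/asboolP/asboolP => /TensSym.
- by move=> /asboolP st /asboolP tu; apply/asboolP/(TensTrans st tu).
Qed.

Canonical tens_equiv := EquivRelPack tens_relb_equiv.

Definition tensor : Type := {eq_quot tens_equiv}.

HB.instance Definition _ := Choice.on tensor.
HB.instance Definition _ := Quotient.on tensor.

Definition tens_class (s : seq (H * f)) : tensor := \pi_tensor s.

Lemma tens_classP s t : tens_rel s t <-> tens_class s = tens_class t.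
Proof.
split=> [st|/eqP]; first by apply/eqmodP/asboolP.
by rewrite eqmodE => /asboolP.
Qed.

Lemma tens_classK t : tens_class (repr t) = t.
Proof. exact: reprK. Qed.

Lemma tens_repr s : tens_rel (repr (tens_class s)) s.
Proof. by apply/tens_classP; rewrite tens_classK. Qed.

Definition tens_add (t u : tensor) := tens_class (repr t ++ repr u).
Definition tens_opp (t : tensor) := tens_class [seq (- p.1, p.2) | p <- repr t].

Lemma tens_addE s t : tens_add (tens_class s) (tens_class t) = tens_class (s ++ t).
Proof. by apply/tens_classP/TensCat; apply: tens_repr. Qed.

Fact tens_addA : associative tens_add.
Proof.
move=> t u v; rewrite -[t]tens_classK -[u]tens_classK -[v]tens_classK.
by rewrite !tens_addE catA.
Qed.

Fact tens_addC : commutative tens_add.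
Proof. by move=> t u; apply/tens_classP/TensCatC. Qed.

Fact tens_add0 : left_id (tens_class [::]) tens_add.
Proof. by move=> t; rewrite -[t]tens_classK tens_addE. Qed.

Fact tens_addN : left_inverse (tens_class [::]) tens_opp tens_add.
Proof.
move=> t; rewrite -{2}[t]tens_classK tens_addE; apply/tens_classP.
elim: (repr t) => [|[x a] s IHs] /=; first exact: TensRefl.
set r := map _ s in IHs *.
have swap : tens_rel (r ++ (x, a) :: s) ((x, a) :: r ++ s).
  rewrite -cat1s catA -[X in tens_rel _ X]cat1s catA.
  exact: TensCat (TensCatC _ _) (TensRefl _).
apply: TensTrans (TensCat (TensRefl [:: (- x, a)]) swap) _.
rewrite -[_ ++ _]/([:: (- x, a); (x, a)] ++ (r ++ s)).
apply: (@TensTrans _ ([::] ++ [::])); last exact: TensRefl.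
apply: TensCat IHs.
apply: TensTrans (TensSym (TensDl (- x) x a)) _.
by rewrite addNr; exact: Tens0.
Qed.

HB.instance Definition _ :=
  GRing.isZmodule.Build tensor tens_addA tens_addC tens_add0 tens_addN.

Definition pure (x : H) (a : f) : tensor := tens_class [:: (x, a)].

Lemma pureDl a : {morph pure^~ a : x y / x + y}.
Proof. by move=> x y; rewrite [RHS]tens_addE; apply/tens_classP/TensDl. Qed.

Lemma pureDr x : {morph pure x : a b / a + b}.
Proof. by move=> a b; rewrite [RHS]tens_addE; apply/tens_classP/TensDr. Qed.

Lemma pureZ x c a : pure (x * val c) a = pure x (k c * a).
Proof. exact/tens_classP/TensBal. Qed.

Lemma tens_class_sum s : tens_class s = \sum_(p <- s) pure p.1 p.2.
Proof.
elim: s => [|[x a] s IHs]; first by rewrite big_nil.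
by rewrite big_cons -IHs [RHS]tens_addE.
Qed.

Lemma tens_ind (P : tensor -> Prop) :
  P 0 -> (forall t u, P t -> P u -> P (t + u)) -> (forall x a, P (pure x a)) ->
  forall t, P t.
Proof.
move=> P0 PD P1 t; rewrite -[t]tens_classK tens_class_sum.
by elim/big_rec: _ => // p u _; apply: PD.
Qed.

Definition balanced (V : zmodType) (g : H -> f -> V) : Prop :=
  [/\ forall a, {morph g^~ a : x y / x + y},
      forall x, {morph g x : a b / a + b}
    & forall x c a, g (x * val c) a = g x (k c * a)].

(* The additive map induced by a balanced map g. *)
Definition tens_lift (V : zmodType) (g : H -> f -> V) (t : tensor) : V :=
  \sum_(p <- repr t) g p.1 p.2.

Section Lift.
Variables (V : zmodType) (g : H -> f -> V).
Hypothesis gP : balanced g.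

Let sum_rel s t :
  tens_rel s t -> \sum_(p <- s) g p.1 p.2 = \sum_(p <- t) g p.1 p.2.
Proof.
case: gP => gl gr gb; elim=> //.
- by move=> s1 t1 u1 _ -> _ ->.
- by move=> s1 s2 t1 t2 _ IHs _ IHt; rewrite !big_cat /= IHs IHt.
- by move=> s1 t1; rewrite !big_cat /= addrC.
- move=> a; rewrite big_seq1 big_nil /=.
  by apply: (addrI (g 0 a)); rewrite -gl !addr0.
- by move=> x y a; rewrite !big_cons !big_nil !addr0 /= gl.
- by move=> x a b; rewrite !big_cons !big_nil !addr0 /= gr.
- by move=> x c a; rewrite !big_seq1 /= gb.
Qed.

Lemma tens_lift_pure x a : tens_lift g (pure x a) = g x a.
Proof. by rewrite /tens_lift (sum_rel (tens_repr _)) big_seq1. Qed.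

Lemma tens_liftD : {morph tens_lift g : t u / t + u}.
Proof.
move=> t u; rewrite -[t]tens_classK -[u]tens_classK [X in tens_lift _ X]tens_addE.
by rewrite /tens_lift !(sum_rel (tens_repr _)) big_cat.
Qed.

Lemma tens_lift0 : tens_lift g 0 = 0.
Proof. by apply: (addrI (tens_lift g 0)); rewrite -tens_liftD !addr0. Qed.

End Lift.

Definition tens_mul (t u : tensor) : tensor :=
  tens_lift (fun x a => tens_lift (fun y b => pure (x * y) (a * b)) u) t.

Let mulr_balanced x a : balanced (fun y b => pure (x * y) (a * b)).
Proof.
split=> [b y z|y b c|y c b].
- by rewrite mulrDr pureDl.
- by rewrite mulrDr pureDr.
- by rewrite mulrA pureZ mulrCA.
Qed.

Let mull_balanced u :
  balanced (fun x a => tens_lift (fun y b => pure (x * y) (a * b)) u).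
Proof.
split.
- move=> a x y; elim/tens_ind: u => [|t u IHt IHu|z b].
  + by rewrite !(tens_lift0 (mulr_balanced _ _)) addr0.
  + by rewrite !(tens_liftD (mulr_balanced _ _)) IHt IHu addrACA.
  + by rewrite !(tens_lift_pure (mulr_balanced _ _)) mulrDl pureDl.
- move=> x a b; elim/tens_ind: u => [|t u IHt IHu|z c].
  + by rewrite !(tens_lift0 (mulr_balanced _ _)) addr0.
  + by rewrite !(tens_liftD (mulr_balanced _ _)) IHt IHu addrACA.
  + by rewrite !(tens_lift_pure (mulr_balanced _ _)) mulrDl pureDr.
- move=> x c a; elim/tens_ind: u => [|t u IHt IHu|z b].
  + by rewrite !(tens_lift0 (mulr_balanced _ _)).
  + by rewrite !(tens_liftD (mulr_balanced _ _)) IHt IHu.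
  + rewrite !(tens_lift_pure (mulr_balanced _ _)) -mulrA.
    by case: c => c cc /=; rewrite (centralP _ cc) -[c]/(val (Centre cc)) mulrA
      pureZ mulrA.
Qed.

Lemma tens_mul_pure x a y b :
  tens_mul (pure x a) (pure y b) = pure (x * y) (a * b).
Proof.
by rewrite /tens_mul (tens_lift_pure (mull_balanced _))
  (tens_lift_pure (mulr_balanced _ _)).
Qed.

Fact tens_mulDl : left_distributive tens_mul +%R.
Proof. by move=> t u v; rewrite /tens_mul (tens_liftD (mull_balanced _)). Qed.

Fact tens_mul0l u : tens_mul 0 u = 0.
Proof. exact: tens_lift0 (mull_balanced _). Qed.

Fact tens_mulDr : right_distributive tens_mul +%R.
Proof.
move=> t u v; elim/tens_ind: t => [|t t' IHt IHt'|x a].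
- by rewrite !tens_mul0l addr0.
- by rewrite !tens_mulDl IHt IHt' addrACA.
by rewrite /tens_mul !(tens_lift_pure (mull_balanced _))
  (tens_liftD (mulr_balanced _ _)).
Qed.

Fact tens_mul0r u : tens_mul u 0 = 0.
Proof. by apply: (addrI (tens_mul u 0)); rewrite -tens_mulDr !addr0. Qed.

Fact tens_mulA : associative tens_mul.
Proof.
move=> t u v; elim/tens_ind: t => [|t t' IHt IHt'|x a].
- by rewrite !tens_mul0l.
- by rewrite !tens_mulDl IHt IHt'.
elim/tens_ind: u => [|u u' IHu IHu'|y b].
- by rewrite !(tens_mul0l, tens_mul0r).
- by rewrite !(tens_mulDl, tens_mulDr) IHu IHu'.
elim/tens_ind: v => [|v v' IHv IHv'|z c].
- by rewrite !(tens_mul0l, tens_mul0r).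
- by rewrite !(tens_mulDl, tens_mulDr) IHv IHv'.
by rewrite !tens_mul_pure !mulrA.
Qed.

Fact tens_mul1 : left_id (pure 1 1) tens_mul.
Proof.
elim/tens_ind => [|t u IHt IHu|x a]; first by rewrite tens_mul0r.
- by rewrite tens_mulDr IHt IHu.
- by rewrite tens_mul_pure !mul1r.
Qed.

Fact tens_1mul : right_id (pure 1 1) tens_mul.
Proof.
elim/tens_ind => [|t u IHt IHu|x a]; first by rewrite tens_mul0l.
- by rewrite tens_mulDl IHt IHu.
- by rewrite tens_mul_pure !mulr1.
Qed.

HB.instance Definition _ := GRing.Zmodule_isPzRing.Build tensor
  tens_mulA tens_mul1 tens_1mul tens_mulDl tens_mulDr.

Lemma pureM x a y b : pure x a * pure y b = pure (x * y) (a * b).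
Proof. exact: tens_mul_pure. Qed.

Definition tens_inl (x : H) : tensor := pure x 1.
Definition tens_inr (a : f) : tensor := pure 1 a.

End Tensor.

Arguments pure {H f} k x a.

Definition tens_map (H : pzRingType) (f f' : comPzRingType)
    (k : centre H -> f) (k' : centre H -> f') (u : f -> f') :
    tensor k -> tensor k' :=
  tens_lift (fun x a => pure k' x (u a)).

Arguments tens_map {H f f'} k k' u.

(* The multiplication map from the tensor product of H and Z(F) to F, for an
   extension j : H -> F. *)
Definition mult_map (H F : pzRingType) (j : H -> F) :
    tensor (centre_map j) -> F :=
  tens_lift (fun x z => j x * val z).

Arguments mult_map {H F} j t.

Definition centre_basis (H : pzRingType) (N : nat) (e : 'I_N -> H) : Prop :=
  forall x : H, exists! c : {ffun 'I_N -> centre H},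
    x = \sum_i val (c i) * e i.

(* d is a splitting field of H, through the isomorphism of d-algebras phi. *)
Definition splitting (H : pzRingType) (d : fieldType)
    (k : centre H -> d) (n : nat) (phi : tensor k -> 'M[d]_n) : Prop :=
  [/\ ring_morphism phi, bijective phi
    & forall c : d, phi (tens_inr k c) = c%:M].

Definition Nrd (H : pzRingType) (d : fieldType) (k : centre H -> d) (n : nat)
    (phi : tensor k -> 'M[d]_n) (x : H) : d :=
  \det (phi (tens_inl k x)).

(* The reduced norm of the generic element x_1 e_1 + ... + x_N e_N, with
   coefficients in d. *)
Definition generic_Nrd (H : pzRingType) (d : fieldType) (k : centre H -> d)
    (n : nat) (phi : tensor k -> 'M[d]_n) (N : nat) (e : 'I_N -> H) :
    {mpoly d[N]} :=
  \det (\sum_i 'X_i *: map_mx (@mpolyC N d) (phi (tens_inl k (e i)))).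

Lemma generic_NrdE (H : nzRingType) (d : fieldType)
    (k : {rmorphism centre H -> d}) (n : nat) (phi : tensor k -> 'M[d]_n)
    (N : nat) (e : 'I_N -> H) (c : 'I_N -> centre H) :
  splitting phi ->
  (generic_Nrd phi e).@[k \o c] = Nrd phi (\sum_i val (c i) * e i).
Proof.
case=> [[phiB [phi1 phiM]] _ phiC].
pose phiD := GRing.isZmodMorphism.Build _ _ phi phiB.
pose phiA : {additive tensor k -> 'M[d]_n} := HB.pack phi phiD.
have inlE : tens_inl k (\sum_i val (c i) * e i) =
    \sum_i tens_inr k (k (c i)) * tens_inl k (e i).
  rewrite /tens_inl (big_morph _ (@pureDl _ _ k 1) (_ : _ = 0)); last first.
    by apply: (addrI (pure k 0 1)); rewrite -pureDl !addr0.
  apply: eq_bigr => j _; rewrite /tens_inr pureM mul1r mulr1.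
  case: (c j) => x cx /=; rewrite (centralP _ cx) -[x]/(val (Centre cx)).
  by rewrite pureZ mulr1.
rewrite /generic_Nrd /Nrd -det_map_mx inlE.
congr (\det _); rewrite raddf_sum [RHS](raddf_sum phiA) /=.
apply: eq_bigr => j _; rewrite phiM phiC -[RHS]/(_ *m _) mul_scalar_mx.
by apply/matrixP => a b; rewrite !mxE mevalM mevalXU mevalC.
Qed.

(* FH, with coefficients in h, is the reduced norm form in the basis e; here
   N = n^2. *)
Definition reduced_norm_form (H : nzRingType) (n : nat) (e : 'I_(n ^ 2) -> H)
    (FH : {mpoly (centre H)[n ^ 2]}) : Prop :=
  exists (d : fieldType) (k : {rmorphism centre H -> d})
         (phi : tensor k -> 'M[d]_n),
    splitting phi /\ map_mpoly k FH = generic_Nrd phi e.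

(* mmap k a P, for values in a possibly zero commutative ring. *)
Definition eval_form (h : nzRingType) (f : comPzRingType) (k : h -> f) (N : nat)
    (P : {mpoly h[N]}) (a : 'I_N -> f) : f :=
  \sum_(m <- msupp P) k P@_m * \prod_(i < N) a i ^+ m i.

Definition only_trivial_zero (h : nzRingType) (f : comPzRingType) (k : h -> f)
    (N : nat) (P : {mpoly h[N]}) : Prop :=
  forall a : 'I_N -> f, eval_form k P a = 0 -> forall i, a i = 0.

(* alpha : G -> Gal(L/K) is a finite embedding problem over K. *)
Definition embedding_problem (K L : pzRingType) (i : K -> L) (G : finGroupType)
    (alpha : G -> gal i) : Prop :=
  [/\ division_ring L, ring_morphism i, galois i,
      {morph alpha : x y / (x * y)%g} & forall s : gal i, exists g, alpha g = s].

(* An extension F of K that contains L, with a map Gal(F/K) -> G. *)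
Record solution_data (K L F : pzRingType) (G : Type) := SolutionData {
  sol_base : K -> F;
  sol_emb : L -> F;
  sol_map :> gal sol_base -> G
}.

(* The last condition is alpha o beta = res, as the relation that each s in
   Gal(F/K) restricts to alpha (beta s). *)
Definition solution (K L : pzRingType) (i : K -> L) (G : finGroupType)
    (alpha : G -> gal i) (F : pzRingType) (beta : solution_data K L F G) : Prop :=
  [/\ division_ring F,
      [/\ ring_morphism (sol_base beta), ring_morphism (sol_emb beta)
        & sol_base beta =1 sol_emb beta \o i],
      galois (sol_base beta),
      {morph beta : s t / (s * t)%g} /\ bijective beta
    & forall s, restricts (sol_emb beta) s (alpha (beta s))].

(* u : F -> F' is an isomorphism over K and L that carries beta to beta'. *)
Definition identifies (K L : pzRingType) (G : Type) (F F' : pzRingType)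
    (beta : solution_data K L F G) (beta' : solution_data K L F' G)
    (u : F -> F') : Prop :=
  [/\ ring_morphism u, bijective u,
      u \o sol_base beta =1 sol_base beta', u \o sol_emb beta =1 sol_emb beta'
    & forall (s : gal (sol_base beta)) (t : gal (sol_base beta')),
        (forall x, u (s x) = t (u x)) -> beta s = beta' t].

(* For beta a solution, restriction from F to Z(F) is bijective, and so is
   mult_map i when L/H is Galois with finite group: the default values of
   inverse_fun below are then never used. *)
Section CheckHat.
Variables (H L : pzRingType) (G : finGroupType) (i : H -> L).

Definition check_problem (alpha : G -> gal i) : G -> gal (centre_map i) :=
  res (@centre_val L) \o alpha.

Definition check (F : pzRingType) (beta : solution_data H L F G) :
    solution_data (centre H) (centre L) (centre F) G :=
  {| sol_base := centre_map (sol_base beta);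
     sol_emb := centre_map (sol_emb beta);
     sol_map := beta \o inverse_fun 1%g (res (@centre_val F)) |}.

(* L is embedded in the tensor product of H and f after being identified with
   the tensor product of H and Z(L) by the multiplication map; the centre of the
   former is identified with f by tens_inr. *)
Definition hat (f : comPzRingType)
    (gamma : solution_data (centre H) (centre L) f G) :
    solution_data H L (tensor (sol_base gamma)) G :=
  {| sol_base := tens_inl (sol_base gamma);
     sol_emb := tens_map (centre_map i) (sol_base gamma) (sol_emb gamma) \o
                inverse_fun 0 (mult_map i);
     sol_map := gamma \o res (tens_inr (sol_base gamma)) |}.

End CheckHat.

(* Main.v *)
Require Import Defs.
From HB Require Import structures.
From mathcomp Require Import all_boot all_algebra all_fingroup.
From mathcomp Require Import finfield boolp classical_sets.
From mathcomp.multinomials Require Import mpoly.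

Set Implicit Arguments.
Unset Strict Implicit.
Unset Printing Implicit Defensive.

Import GRing.Theory.
Local Open Scope ring_scope.

(** The theorem rests on one observation.  Call an extension [F] of [H] outer
    if the centralizer [f] of [H] in [F] is central in [F].  Since
    [H] has finite dimension over [h], every [h]-linear map from [H] to [H],
    and in particular every coordinate function ([sandwich_coord]), is a
    sandwich operator [x |-> sum_m p_m x q_m] with [p_m], [q_m] in [H], and identities between such operators persist in every
    ring over [H] in which [h] is central ([sandwich_transfer]).  Applied to the
    coordinate functions of [H], this splits [F] as the tensor product of [H]
    and [f] over [h] ([oe_mult_bij]).  So automorphisms of [F] over [H] and of
    [f] over [h] correspond by restriction ([res_bij]), and [F/H] is Galois
    exactly when [f/h] is ([oe_galois]).

    Both sides of the correspondence consist of outer extensions.  If [F/H] is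
    Galois with finite group, then [F] is outer over [H], with [f] the centre of
    [F] ([galois_outer]): a non-central element [w] commuting with [H] would
    give infinitely many inner automorphisms over [H], by conjugation with
    [w + a] for [a] central, unless the centre of [F] is finite; but then [h],
    [H] and finally [F] are finite, and Wedderburn's theorem makes [F]
    commutative ([centralizer_central]).  If [f/h] is given and the reduced norm
    form has only the trivial zero over [f], then the tensor product is a
    division ring ([trivial_zero_tensor]), and it is outer over [H]
    ([tensor_outer]).

    The link between the norm form and zero divisors is that the determinant of
    right multiplication by the generic element of [H] is the [n]-th power of
    the reduced norm form ([regular_formE]).  The coefficients of that determinant
    come from the structure constants of [H] over [h], so over [f] it detects the
    zero divisors of the tensor product, although [f] need not be related to the
    splitting field that defines the form.

    Given all this, solutions are compared by checking that ring morphisms agree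
    on [H] and on the centralizing field, which determine them ([oe_eq]). *)

(** * Division rings and their centres *)

Section RingMorphism.
Variables (R S : pzRingType) (g : R -> S).
Hypothesis gM : ring_morphism g.

Definition rmorphism_of : {rmorphism R -> S} :=
  HB.pack g (GRing.isZmodMorphism.Build R S g gM.1)
            (GRing.isMonoidMorphism.Build R S g gM.2).

Lemma rmB : {morph g : x y / x - y}. Proof. exact: gM.1. Qed.
Lemma rm0 : g 0 = 0. Proof. exact: (rmorph0 rmorphism_of). Qed.
Lemma rmN : {morph g : x / - x}. Proof. exact: (rmorphN rmorphism_of). Qed.
Lemma rmD : {morph g : x y / x + y}. Proof. exact: (rmorphD rmorphism_of). Qed.
Lemma rm1 : g 1 = 1. Proof. exact: gM.2.1. Qed.
Lemma rmM : {morph g : x y / x * y}. Proof. exact: gM.2.2. Qed.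

Lemma rm_sum (I : Type) (r : seq I) (P : pred I) (E : I -> R) :
  g (\sum_(i <- r | P i) E i) = \sum_(i <- r | P i) g (E i).
Proof. exact: (rmorph_sum rmorphism_of). Qed.

Lemma rm_inj : division_ring R -> (1 : S) != 0 -> injective g.
Proof.
move=> [_ inv] S1 x y /eqP; rewrite -subr_eq0 -rmB => /eqP gxy.
apply/eqP; rewrite -subr_eq0; apply/negP => /negP /inv [z [xz _]].
by case/eqP: S1; rewrite -rm1 -xz rmM gxy mul0r.
Qed.

End RingMorphism.

Lemma rm_comp (R S T : pzRingType) (g : R -> S) (g' : S -> T) :
  ring_morphism g -> ring_morphism g' -> ring_morphism (g' \o g).
Proof.
move=> gM g'M; split=> [x y|]; first by rewrite /= (rmB gM) (rmB g'M).
by split=> [|x y] /=; rewrite ?(rm1 gM) ?(rm1 g'M) ?(rmM gM) ?(rmM g'M).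
Qed.

Lemma rm_cancel (R S : pzRingType) (g : R -> S) (g' : S -> R) :
  ring_morphism g -> cancel g g' -> cancel g' g -> ring_morphism g'.
Proof.
move=> gM gK g'K; split=> [x y|].
  by apply: (can_inj gK); rewrite (rmB gM) !g'K.
by split=> [|x y]; apply: (can_inj gK); rewrite ?(rm1 gM) ?(rmM gM) !g'K.
Qed.

Lemma centre_val_morphism (R : pzRingType) : ring_morphism (val : centre R -> R).
Proof. by []. Qed.

Lemma centre_valC (R : pzRingType) (c : centre R) (x : R) :
  val c * x = x * val c.
Proof. by case: c => c /= /centralP. Qed.

Lemma centre_division (R : pzRingType) :
  division_ring R -> division_ring (centre R).
Proof.
move=> [R1 inv]; split=> [//|c c0].
have [y [cy yc]] : exists y, val c * y = 1 /\ y * val c = 1.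
  by apply: inv; rewrite -(inj_eq val_inj) in c0.
have yC : y \in @central R.
  apply/centralP => z; rewrite -[y * z]mulr1 -cy mulrA -[y * z * _]mulrA.
  by rewrite -centre_valC mulrA yc mul1r.
by exists (Centre yC); split; apply: val_inj.
Qed.

(** A commutative division ring carries a field structure.  The ring is taken
    apart into its operations so that forgetting this structure gives it back by
    computation, and no transport is needed in [P]. *)
Lemma field_ind (P : comPzRingType -> Prop) :
  (forall f : fieldType, P f) ->
  forall f : comPzRingType, division_ring f -> P f.
Proof.
move=> Pf [T [? ? ? m4 ? ? ? ? ? ? m11]] [f1 inv].
pose f : comPzRingType :=
  GRing.ComPzRing.Pack (GRing.ComPzRing.Class m4 m11).
pose nz := GRing.PzSemiRing_isNonZero.Build f f1.
pose fN : comNzRingType := HB.pack T f nz.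
pose iv (x : f) := xget (0 : f) [set y | x * y = 1 /\ y * x = 1]%classic.
have ivM (x : fN) : x != 0 -> iv x * x = 1.
  by move=> /inv /(@xgetPex f 0) [].
have iv0 : iv 0 = 0.
  rewrite /iv; case: xgetP => // y _ [].
  by rewrite mul0r => /esym/eqP; rewrite (negbTE f1).
pose fF : fieldType := HB.pack fN (GRing.ComNzRing_isField.Build fN ivM iv0).
exact: (Pf fF).
Qed.

(** * Coordinates and sandwich operators over the centre *)

Lemma inj_mulmx_surj (R : comPzRingType) m (A : 'M[R]_m) :
  division_ring R -> (forall v : 'rV_m, v *m A = 0 -> v = 0) ->
  forall w : 'rV_m, exists v : 'rV_m, v *m A = w.
Proof.
move=> Rdiv; move: R Rdiv A; apply: field_ind => R A inj w.
have Au : A \in unitmx.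
  rewrite -row_free_unit -kermx_eq0; apply/eqP/row_matrixP => a.
  by rewrite row0; apply: inj; apply/sub_kermxP; rewrite row_sub.
by exists (w *m invmx A); rewrite mulmxKV.
Qed.

Section Coordinates.
Variables (H : nzRingType) (N : nat) (e : 'I_N -> H).
Hypothesis eP : centre_basis e.

Definition coord (x : H) : {ffun 'I_N -> centre H} :=
  projT1 (cid (eP x)).

Lemma coordE x : x = \sum_l val (coord x l) * e l.
Proof. by rewrite /coord; case: cid => c []. Qed.

Lemma coord_sum (c : 'I_N -> centre H) l :
  coord (\sum_m val (c m) * e m) l = c l.
Proof.
rewrite /coord; case: cid => d [_ /= /(_ [ffun m => c m])].
by move=> ->; rewrite ?ffunE //; apply: eq_bigr => m _; rewrite ffunE.
Qed.

Lemma coordD x y l : coord (x + y) l = coord x l + coord y l.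
Proof.
rewrite -(coord_sum (fun m => coord x m + coord y m)); congr (coord _ _).
by under eq_bigr do rewrite raddfD mulrDl; rewrite big_split /= -!coordE.
Qed.

Lemma coordZ (c : centre H) x l : coord (val c * x) l = c * coord x l.
Proof.
rewrite -(coord_sum (fun m => c * coord x m)); congr (coord _ _).
by rewrite {1}(coordE x) mulr_sumr; apply: eq_bigr => m _; rewrite mulrA.
Qed.

Lemma coordMr (c : centre H) x l : coord (x * val c) l = coord x l * c.
Proof. by rewrite -centre_valC coordZ mulrC. Qed.

Lemma coord0 l : coord 0 l = 0.
Proof. by apply: (addrI (coord 0 l)); rewrite -coordD !addr0. Qed.

Lemma coord_basis m l : coord (e m) l = (m == l)%:R.
Proof.
rewrite -(coord_sum (fun l => (m == l)%:R)); congr (coord _ _).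
rewrite (bigD1 m) //= eqxx mul1r big1 ?addr0 // => p /negbTE.
by rewrite eq_sym => ->; rewrite mul0r.
Qed.

Hypothesis Hdiv : division_ring H.

(** In a relation with as few nonzero coefficients as possible, one of them may
    be taken to be 1; the commutator of the relation with [y] is shorter, so
    all coefficients are central, which contradicts the freeness of [e]. *)
Lemma sandwich_free (p : 'I_N -> H) :
  (forall x, \sum_l p l * x * e l = 0) -> forall l, p l = 0.
Proof.
have [s] := ubnP #|[pred l | p l != 0]|; elim: s p => // s IHs p ps pe.
apply: contrapT => /existsNP[l0 /eqP pl0].
have [q [pq qp]] := Hdiv.2 _ pl0.
have comm y l : q * p l * y = y * (q * p l).
  apply/eqP; rewrite -subr_eq0; apply/eqP; move: l.
  apply: IHs => [|x]; last first.
    transitivity (q * (\sum_l p l * (y * x) * e l) -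
                  y * q * \sum_l p l * x * e l); last by rewrite !pe !mulr0 subrr.
    rewrite !mulr_sumr -sumrB; apply: eq_bigr => l _.
    by rewrite !mulrBl !mulrA.
  rewrite ltnS in ps; apply: (leq_trans _ ps).
  apply: proper_card; apply/properP; split.
    apply/fintype.subsetP => l; rewrite !inE; apply: contraNneq => ->.
    by rewrite mulr0 mul0r mulr0 subrr.
  by exists l0; rewrite !inE ?pl0 // qp mul1r mulr1 subrr eqxx.
have qpC l : q * p l \in @central H by apply/centralP => y; apply: comm.
have := coord_sum (fun l => Centre (qpC l)) l0.
rewrite (_ : \sum_m _ = 0) => [/(congr1 val) /=|].
  by rewrite qp coord0 => /esym/eqP; rewrite (negbTE Hdiv.1).
rewrite (eq_bigr (fun l => q * (p l * 1 * e l))) => [|l _].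
  by rewrite -mulr_sumr pe mulr0.
by rewrite /= mulr1 mulrA.
Qed.

(** The operators [x |-> sum_(a, m) c_(a, m) e_a x e_m] depend injectively on
    the matrix [c], by [sandwich_free], and these matrices form a space of the
    same dimension as the [h]-linear endomorphisms of [H]. *)
Lemma sandwich_coord l : exists p : 'I_N -> H,
  forall x, \sum_m p m * x * e m = val (coord x l).
Proof.
pose op (c : 'M[centre H]_N) m := \sum_a val (c a m) * e a.
pose Phi (c : 'M[centre H]_N) : 'M[centre H]_N :=
  \matrix_(a, b) coord (\sum_m op c m * e a * e m) b.
have opD a c d m : op (a *: c + d) m = val a * op c m + op d m.
  rewrite /op mulr_sumr -big_split; apply: eq_bigr => b _ /=.
  by rewrite !mxE -[val _]/(val a * val (c b m) + val (d b m)) mulrDl mulrA.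
have PhiL : linear Phi.
  move=> a c d; apply/matrixP => b b'; rewrite !mxE -coordZ -coordD.
  congr (coord _ _); rewrite mulr_sumr -big_split; apply: eq_bigr => m _ /=.
  by rewrite opD !mulrDl !mulrA.
pose PhiA := GRing.isLinear.Build _ _ _ _ _ PhiL.
pose PhiR : {linear 'M[centre H]_N -> 'M[centre H]_N} := HB.pack Phi PhiA.
have opE c x : \sum_m op c m * x * e m =
    \sum_b val (\sum_a coord x a * Phi c a b) * e b.
  rewrite {1}(coordE x).
  transitivity (\sum_a val (coord x a) * \sum_m op c m * e a * e m).
    under [RHS]eq_bigr do rewrite mulr_sumr; rewrite exchange_big /=.
    apply: eq_bigr => m _; rewrite mulr_sumr mulr_suml; apply: eq_bigr => a _.
    by rewrite !mulrA centre_valC.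
  under eq_bigr do rewrite (coordE (\sum_m _)) mulr_sumr.
  rewrite exchange_big /=; apply: eq_bigr => b _.
  rewrite (rm_sum (@centre_val_morphism H)) mulr_suml.
  by apply: eq_bigr => a _; rewrite mxE mulrA.
have inj (v : 'rV_(N * N)) : v *m lin_mx PhiR = 0 -> v = 0.
  rewrite mul_rV_lin => /(congr1 vec_mx); rewrite mxvecK linear0 => c0.
  rewrite -[v]vec_mxK; set c := vec_mx v in c0 *; have {}c0 : Phi c = 0 := c0.
  suff -> : c = 0 by rewrite linear0.
  have op0 : forall m, op c m = 0.
    apply: sandwich_free => x; rewrite opE big1 // => b _.
    rewrite big1 ?(rm0 (@centre_val_morphism H)) ?mul0r // => a _.
    by rewrite c0 mxE mulr0.
  apply/matrixP => a m; rewrite [RHS]mxE.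
  by rewrite -(coord_sum (c^~ m)) -/(op c m) op0 coord0.
(* The target is the matrix of the map x |-> coord x l * 1. *)
have [v] := inj_mulmx_surj (centre_division Hdiv) inj
  (mxvec (\matrix_(a, b) ((a == l)%:R * coord 1 b))).
rewrite mul_rV_lin => /(can_inj mxvecK) vE.
have {}vE : Phi (vec_mx v) = _ := vE.
exists (op (vec_mx v)) => x; rewrite opE.
transitivity (val (coord x l) * 1); last by rewrite mulr1.
rewrite [in RHS](coordE 1) mulr_sumr; apply: eq_bigr => b _.
rewrite mulrA; congr (_ * _); rewrite -[RHS]/(val (coord x l * coord 1 b)).
congr (val _); rewrite (bigD1 l) //= big1 => [|a /negbTE al].
  by rewrite vE mxE eqxx mul1r addr0.
by rewrite vE mxE al mul0r mulr0.
Qed.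

Section Transfer.
Variables (F : pzRingType) (j : H -> F).
Hypothesis jM : ring_morphism j.
Hypothesis jC : forall (c : centre H) z, j (val c) * z = z * j (val c).

Let normal (I : finType) (A B : I -> H) z :
  \sum_i j (A i) * z * j (B i) =
    \sum_m j (\sum_i A i * val (coord (B i) m)) * z * j (e m).
Proof.
under [RHS]eq_bigr do rewrite (rm_sum jM) !mulr_suml.
rewrite exchange_big /=; apply: eq_bigr => i _.
rewrite {1}(coordE (B i)) (rm_sum jM) mulr_sumr; apply: eq_bigr => m _.
by rewrite !(rmM jM) -!mulrA; congr (_ * _); rewrite !mulrA jC.
Qed.

(** Expanding the right-hand factors in the basis [e] puts both sides in a
    normal form whose coefficients are determined by the operator on [H]; the
    same expansion is valid in [F], where the image of [h] is central. *)
Lemma sandwich_transfer (I I' : finType) (A B : I -> H) (A' B' : I' -> H) :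
  (forall x, \sum_i A i * x * B i = \sum_i A' i * x * B' i) ->
  forall z, \sum_i j (A i) * z * j (B i) = \sum_i j (A' i) * z * j (B' i).
Proof.
move=> AB z; rewrite normal [RHS]normal; apply: eq_bigr => m _.
congr (j _ * _ * _).
apply/eqP; rewrite -subr_eq0; apply/eqP; move: m.
apply: sandwich_free => x; under eq_bigr do rewrite !mulrBl; rewrite sumrB.
apply/eqP; rewrite subr_eq0; apply/eqP.
have nrm (J : finType) (C D : J -> H) : \sum_i C i * x * D i =
    \sum_m (\sum_i C i * val (coord (D i) m)) * x * e m.
  under [RHS]eq_bigr do rewrite !mulr_suml.
  rewrite exchange_big /=; apply: eq_bigr => i _.
  rewrite {1}(coordE (D i)) mulr_sumr; apply: eq_bigr => m _.
  by rewrite -!mulrA; congr (_ * _); rewrite !mulrA centre_valC.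
by rewrite -nrm AB nrm.
Qed.

End Transfer.

End Coordinates.

(** * The tensor product as a free module over the second factor *)

Section TensorCoordinates.
Variables (H : nzRingType) (N : nat) (e : 'I_N -> H).
Hypothesis eP : centre_basis e.
Variables (f : comPzRingType) (k : centre H -> f).
Hypothesis kM : ring_morphism k.

Lemma pure_sum (I : finType) (E : I -> H) a :
  pure k (\sum_i E i) a = \sum_i pure k (E i) a.
Proof.
apply: (big_morph (pure k ^~ a)) => [x y|]; first exact: pureDl.
by apply: (addrI (pure k 0 a)); rewrite -pureDl !addr0.
Qed.

Lemma pure0r x : pure k x 0 = 0.
Proof. by apply: (addrI (pure k x 0)); rewrite -pureDr !addr0. Qed.

(** The coordinates in the basis of the [pure k (e l) 1]. *)
Definition tcoord (l : 'I_N) : tensor k -> f :=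
  tens_lift (fun x a => k (coord eP x l) * a).

Let tcoord_balanced l : balanced k (fun x a => k (coord eP x l) * a).
Proof.
split=> [a x y|x a b|x c a]; first by rewrite coordD (rmD kM) mulrDl.
- by rewrite mulrDr.
- by rewrite coordMr (rmM kM) mulrA.
Qed.

Lemma tcoord_pure l x a : tcoord l (pure k x a) = k (coord eP x l) * a.
Proof. exact: (tens_lift_pure (tcoord_balanced l)). Qed.

Lemma tcoordD l : {morph tcoord l : t u / t + u}.
Proof. exact: (tens_liftD (tcoord_balanced l)). Qed.

Lemma tcoord0 l : tcoord l 0 = 0.
Proof. exact: (tens_lift0 (tcoord_balanced l)). Qed.

Lemma tcoord_sum (a : 'I_N -> f) l :
  tcoord l (\sum_m pure k (e m) (a m)) = a l.
Proof.
rewrite (big_morph (tcoord l) (tcoordD l) (tcoord0 l)) (bigD1 l) //= big1.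
  by rewrite tcoord_pure coord_basis eqxx (rm1 kM) mul1r addr0.
move=> m /negbTE ml; rewrite tcoord_pure coord_basis ml.
by rewrite (rm0 kM) mul0r.
Qed.

Lemma tensorE t : t = \sum_m pure k (e m) (tcoord m t).
Proof.
elim/tens_ind: t => [|t u {1}-> {1}->|x a].
- by rewrite big1 // => m _; rewrite tcoord0 pure0r.
- by rewrite -big_split; apply: eq_bigr => m _ /=; rewrite tcoordD pureDr.
rewrite {1}(coordE eP x) pure_sum; apply: eq_bigr => m _.
by rewrite centre_valC pureZ tcoord_pure.
Qed.

(** Right multiplication by [e i], acting on rows of coordinates. *)
Definition struct_mx (i : 'I_N) : 'M[centre H]_N :=
  \matrix_(l, m) coord eP (e l * e i) m.

Lemma tcoordM t u :
  \row_m tcoord m (t * u) =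
    \row_m tcoord m t *m \sum_i tcoord i u *: map_mx k (struct_mx i).
Proof.
apply/rowP => m; rewrite !mxE {1}(tensorE t) {1}(tensorE u).
rewrite mulr_suml (big_morph (tcoord m) (tcoordD m) (tcoord0 m)).
apply: eq_bigr => l _; rewrite mulr_sumr !mxE summxE mulr_sumr.
rewrite (big_morph (tcoord m) (tcoordD m) (tcoord0 m)).
by apply: eq_bigr => i _; rewrite pureM tcoord_pure !mxE mulrC -mulrA.
Qed.

End TensorCoordinates.

(** * The reduced norm form and zero divisors in the tensor product *)

Section Flatten.
Variables (R : comNzRingType) (n : nat).

(** Rows are concatenated recursively, rather than with [mxvec], so that right
    multiplication becomes block diagonal and its determinant is immediate. *)
Fixpoint flatten_mx p : 'M[R]_(p, n) -> 'rV[R]_(p * n) :=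
  match p with
  | 0 => fun=> 0
  | p'.+1 => fun B : 'M_(1 + p', n) =>
      row_mx (usubmx B) (flatten_mx (dsubmx B)) : 'rV_(n + p' * n)
  end.

Fixpoint diag_copies (A : 'M[R]_n) p : 'M[R]_(p * n) :=
  match p with
  | 0 => 1%:M
  | p'.+1 => block_mx A 0 0 (diag_copies A p') : 'M_(n + p' * n)
  end.

Lemma flatten_mul p (B : 'M_(p, n)) A :
  flatten_mx (B *m A) = flatten_mx B *m diag_copies A p.
Proof.
elim: p => [|p IHp] in B *; first by rewrite mul0mx.
rewrite [LHS]/= [in RHS]/= [RHS](@mul_row_block _ 1 n (p * n)).
rewrite !mulmx0 addr0 add0r -IHp.
by rewrite -[in LHS](@mul_usub_mx _ 1 p) -[in LHS](@mul_dsub_mx _ 1 p).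
Qed.

Lemma det_diag_copies A p : \det (diag_copies A p) = \det A ^+ p.
Proof.
elim: p => [|p IHp]; first by rewrite det1.
by rewrite [LHS](@det_ublock _ n (p * n)) IHp exprS.
Qed.

Lemma flatten_linear p : linear (@flatten_mx p).
Proof.
elim: p => [|p IHp] a B C /=; first by rewrite scaler0 addr0.
rewrite (scale_row_mx a) add_row_mx -IHp; congr row_mx.
  by apply/matrixP => x y; rewrite !mxE.
by congr (flatten_mx _); apply/matrixP => x y; rewrite !mxE.
Qed.

Lemma flatten_eq0 p (B : 'M_(p, n)) : flatten_mx B = 0 -> B = 0.
Proof.
elim: p => [|p IHp] in B * => [_|/= /eqP]; first by apply/matrixP => -[].
rewrite (@row_mx_eq0 _ 1 n (p * n)) => /andP[/eqP u0 /eqP /IHp d0].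
by rewrite -[B](@vsubmxK _ 1 p) u0 d0 col_mx0.
Qed.

End Flatten.

Lemma map_flatten (R S : comNzRingType) (g : {rmorphism R -> S}) n p
    (B : 'M_(p, n)) :
  map_mx g (flatten_mx B) = flatten_mx (map_mx g B).
Proof.
elim: p => [|p IHp] in B *; first by rewrite map_mx0.
by rewrite [LHS](@map_row_mx _ _ _ 1 n (p * n)) IHp /= map_usubmx map_dsubmx.
Qed.

Section ReducedNorm.
Variables (H : nzRingType) (n : nat) (e : 'I_(n * n) -> H).
Hypothesis eP : centre_basis e.

Section Splitting.
Variables (d : fieldType) (k : {rmorphism centre H -> d}).
Variable phi : tensor k -> 'M[d]_n.
Hypothesis phiP : splitting phi.

Let kM : ring_morphism k.
Proof. by split; [exact: rmorphB|split; [exact: rmorph1|exact: rmorphM]]. Qed.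

Let phiE l := phi (tens_inl k (e l)).

Let phi_pure x a : phi (pure k x a) = a *: phi (tens_inl k x).
Proof.
case: phiP => phiM _ phiC; rewrite -mul_scalar_mx -phiC.
rewrite -[RHS](rmM phiM); congr phi.
by rewrite /tens_inl /tens_inr pureM mul1r mulr1.
Qed.

Let phiE_mul l i :
  phiE l *m phiE i = \sum_m k (struct_mx eP i l m) *: phiE m.
Proof.
case: phiP => phiM _ _; rewrite -[LHS](rmM phiM) /tens_inl pureM mulr1.
rewrite (coordE eP (e l * e i)) pure_sum (rm_sum phiM); apply: eq_bigr => m _.
by rewrite centre_valC pureZ mulr1 phi_pure mxE.
Qed.

Let Q : 'M[d]_(n * n) := \matrix_l flatten_mx (phiE l).

Let Q_det : \det Q != 0.
Proof.
case: phiP => phiM /bij_inj phiI _; apply/negP => /det0P[v /eqP v0].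
rewrite mulmx_sum_row => vQ; apply: v0; apply/rowP => l; rewrite mxE.
rewrite -(tcoord_sum eP kM (fun l => v 0 l)).
suff -> : \sum_m pure k (e m) (v 0 m) = 0 by rewrite tcoord0.
apply: phiI; rewrite (rm0 phiM) (rm_sum phiM); apply: flatten_eq0.
pose flA := GRing.isLinear.Build _ _ _ _ _ (@flatten_linear d n n).
pose fl : {linear 'M[d]_n -> 'rV[d]_(n * n)} := HB.pack (@flatten_mx d n n) flA.
rewrite -vQ -[LHS]/(fl _) linear_sum; apply: eq_bigr => m _.
by rewrite rowK phi_pure linearZ.
Qed.

(** The splitting [phi] turns the coordinates in the basis [e] into matrix
    entries; this change of basis, of matrix [Q], conjugates right
    multiplication by the generic element of [H] into right multiplication by a
    matrix on the [n] rows of an [n x n] matrix. *)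
Lemma det_struct_generic :
  \det (\sum_i 'X_i *: map_mx (@mpolyC (n * n) d) (map_mx k (struct_mx eP i)))
    = generic_Nrd phi e ^+ n.
Proof.
rewrite /generic_Nrd -det_diag_copies; set Reg := \sum_i _ *: _.
set xi := \sum_i _ *: _.
pose C := @mpolyC (n * n) d.
suff RQ : Reg *m map_mx C Q = map_mx C Q *m diag_copies xi n.
  have /(congr1 determinant) := RQ; rewrite !det_mulmx mulrC.
  by apply: mulfI; rewrite det_map_mx mpolyC_eq0.
pose flA := GRing.isLinear.Build _ _ _ _ _ (@flatten_linear {mpoly d[n * n]} n n).
pose fl : {linear 'M[{mpoly d[n * n]}]_n -> 'rV_(n * n)} :=
  HB.pack (@flatten_mx {mpoly d[n * n]} n n) flA.
have rowQ l : row l (map_mx C Q) = fl (map_mx C (phiE l)).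
  by rewrite -map_row rowK map_flatten.
apply/row_matrixP => l; rewrite !row_mul rowQ -flatten_mul -[RHS]/(fl _).
rewrite mulmx_sum_row mulmx_sumr [RHS]linear_sum.
transitivity (\sum_i 'X_i *: \sum_m (C (k (struct_mx eP i l m))) *:
    fl (map_mx C (phiE m))).
  under [RHS]eq_bigr do rewrite scaler_sumr; rewrite exchange_big.
  apply: eq_bigr => m _; rewrite rowQ !mxE summxE scaler_suml.
  by apply: eq_bigr => i _; rewrite !mxE scalerA.
apply: eq_bigr => i _; rewrite -scalemxAr linearZ; congr (_ *: _).
rewrite -map_mxM phiE_mul map_mx_sum linear_sum; apply: eq_bigr => m _.
by rewrite map_mxZ linearZ.
Qed.

End Splitting.

(** The norm of the right regular representation of [H], as a form over [h]. *)
Definition regular_form : {mpoly (centre H)[n * n]} :=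
  \det (\sum_i 'X_i *: map_mx (@mpolyC (n * n) (centre H)) (struct_mx eP i)).

Lemma map_regular_form (f : comNzRingType) (k : {rmorphism centre H -> f}) :
  map_mpoly k regular_form =
    \det (\sum_i 'X_i *: map_mx (@mpolyC (n * n) f) (map_mx k (struct_mx eP i))).
Proof.
rewrite /regular_form -det_map_mx map_mx_sum; congr (\det _).
apply: eq_bigr => i _; rewrite map_mxZ -!map_mx_comp.
congr (_ *: _); first exact: map_mpolyX.
by apply/matrixP => a b; rewrite !mxE /= map_mpolyC.
Qed.

Hypothesis Hdiv : division_ring H.

(** The identity holds after extension of scalars to a splitting field, and the
    embedding of [h] in it is injective on polynomials. *)
Lemma regular_formE (FH : {mpoly (centre H)[n * n]}) :
  @reduced_norm_form H n e FH -> regular_form = FH ^+ n.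
Proof.
case=> d [k [phi [phiP FHE]]].
have kI : injective k.
  apply: rm_inj (centre_division Hdiv) (oner_neq0 _).
  by split; [exact: rmorphB|split; [exact: rmorph1|exact: rmorphM]].
have kR : map_mpoly k regular_form = map_mpoly k (FH ^+ n).
  by rewrite map_regular_form (det_struct_generic phiP) -FHE rmorphXn.
apply/mpolyP => m; apply: kI.
by rewrite -!mcoeff_map_mpoly kR.
Qed.

Lemma eval_regular_form (f : comNzRingType) (k : {rmorphism centre H -> f}) a :
  eval_form k regular_form a = \det (\sum_i a i *: map_mx k (struct_mx eP i)).
Proof.
rewrite -[LHS]/(mmap k a regular_form) /regular_form -det_map_mx map_mx_sum.
congr (\det _); apply: eq_bigr => i _; rewrite map_mxZ; congr (_ *: _).
  by rewrite -[LHS]/(mmap k a 'X_i) mmapX mmap1U.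
by rewrite -map_mx_comp; apply/matrixP => x y; rewrite !mxE /= mmapC.
Qed.

End ReducedNorm.

Lemma division_left_inv (R : pzRingType) :
  (1 : R) != 0 -> (forall x : R, x != 0 -> exists y, y * x = 1) ->
  division_ring R.
Proof.
move=> R1 inv; split=> // x x0; have [y yx] := inv x x0.
have y0 : y != 0 by apply: contraNneq R1 => y0; rewrite -yx y0 mul0r.
have [z zy] := inv y y0; exists y; split=> //.
by have <- : z = x by rewrite -[LHS]mulr1 -yx mulrA zy mul1r.
Qed.

Section NormForm.
Variables (H : nzRingType) (n : nat) (e : 'I_(n ^ 2) -> H).
Variable FH : {mpoly (centre H)[n ^ 2]}.
Hypotheses (Hdiv : division_ring H) (eP : centre_basis e).
Hypothesis FHP : reduced_norm_form e FH.

Let n_gt0 : (0 < n)%N.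
Proof.
move: (oner_neq0 H); rewrite (coordE eP 1); move: (coord _ _).
move: (eP); move: e; case: n => // e0 _ c /eqP []; rewrite big1 // => -[l lt0] _.
by exfalso; move: lt0; rewrite exp0n.
Qed.

(** Over [f], the value of the norm form at the coordinates of [t] vanishes
    exactly when right multiplication by [t] is singular. *)
Theorem trivial_zero_tensor (f : comPzRingType) (k : centre H -> f) :
  division_ring f -> ring_morphism k ->
  only_trivial_zero k FH <-> division_ring (tensor k).
Proof.
move=> fdiv; move: f fdiv k; apply: field_ind => f k kM.
pose kR := rmorphism_of kM.
pose vec (t : tensor k) : 'rV[f]_(n * n) := \row_l tcoord eP l t.
pose ten (v : 'rV[f]_(n * n)) : tensor k := \sum_m pure k (e m) (v 0 m).
have vecK : cancel vec ten.
  by move=> t; rewrite [RHS](tensorE eP kM); apply: eq_bigr => m _; rewrite mxE.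
have tenK : cancel ten vec.
  by move=> v; apply/rowP => m; rewrite mxE (tcoord_sum eP kM (fun m => v 0 m)).
have vec0 : vec 0 = 0 by apply/rowP => m; rewrite !mxE tcoord0.
have ten0 : ten 0 = 0 by rewrite -vec0 vecK.
pose Reg (a : 'I_(n * n) -> f) : 'M[f]_(n * n) :=
  \sum_i a i *: map_mx kR (struct_mx eP i).
have vecM t u : vec (t * u) = vec t *m Reg (fun i => tcoord eP i u).
  exact: (tcoordM eP kM).
have RegE a : \det (Reg a) = eval_form k FH a ^+ n.
  transitivity (eval_form kR (regular_form eP) a).
    by rewrite eval_regular_form.
  rewrite (regular_formE eP Hdiv FHP).
  by rewrite -[LHS]/(mmap kR a (FH ^+ n)) rmorphXn.
split=> [triv|[T1 inv] a a0 l].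
  apply: division_left_inv => [|t t0].
    apply: contraNneq (oner_neq0 H) => T1; apply/eqP.
    rewrite (coordE eP 1) big1 // => l _.
    suff -> : coord eP 1 l = 0 by rewrite mul0r.
    apply: (rm_inj kM (centre_division Hdiv) (oner_neq0 f)).
    transitivity (tcoord eP l (1 : tensor k)).
      by rewrite [RHS](tcoord_pure eP kM) mulr1.
    by rewrite T1 (tcoord0 eP kM) (rm0 kM).
  have Ru : Reg (fun i => tcoord eP i t) \in unitmx.
    rewrite unitmxE unitfE RegE; apply/expf_neq0/eqP => /triv tc0.
    case/eqP: t0; rewrite -[t]vecK; suff -> : vec t = 0 by [].
    by apply/rowP => l; rewrite !mxE tc0.
  exists (ten (vec 1 *m invmx (Reg (fun i => tcoord eP i t)))).
  by rewrite -[LHS]vecK vecM tenK mulmxKV ?vecK.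
apply: contrapT => /eqP al0; set t := ten (\row_m a m).
have tc i : tcoord eP i t = a i.
  by rewrite /t (tcoord_sum eP kM (fun m => (\row_m a m) 0 m)) mxE.
have t0 : t != 0.
  by apply: contraNneq al0 => t0; rewrite -tc t0 tcoord0.
have /eqP/det0P[v /eqP v0 vR] : \det (Reg (fun i => tcoord eP i t)) = 0.
  rewrite RegE (_ : (fun i => _) = a) ?a0 ?expr0n ?gtn_eqF //.
  by apply/funext => i.
have [u [tu _]] := inv t t0; case: v0; rewrite -[v]tenK.
suff -> : ten v = 0 by rewrite vec0.
rewrite -[LHS]mulr1 -tu mulrA (_ : ten v * t = 0) ?mul0r //.
by rewrite -[LHS]vecK vecM tenK vR ten0.
Qed.

End NormForm.

(** * Morphisms out of the tensor product *)

Section Multiplication.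
Variables (H : nzRingType) (f : comPzRingType) (k : centre H -> f).

Lemma tens_eq (F : pzRingType) (g g' : tensor k -> F) :
  ring_morphism g -> ring_morphism g' ->
  (forall x, g (tens_inl k x) = g' (tens_inl k x)) ->
  (forall a, g (tens_inr k a) = g' (tens_inr k a)) -> g =1 g'.
Proof.
move=> gM g'M gl gr t; elim/tens_ind: t => [|t u IHt IHu|x a].
- by rewrite (rm0 gM) (rm0 g'M).
- by rewrite (rmD gM) (rmD g'M) IHt IHu.
have -> : pure k x a = tens_inl k x * tens_inr k a by rewrite pureM mulr1 mul1r.
by rewrite (rmM gM) (rmM g'M) gl gr.
Qed.

Lemma tens_inl_morphism : ring_morphism (tens_inl k).
Proof.
split=> [x y|]; last by split=> [//|x y]; rewrite /tens_inl pureM mulr1.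
apply: (addIr (tens_inl k y)); rewrite subrK -[LHS]pureDl.
by rewrite subrK.
Qed.

Lemma tens_inr_morphism : ring_morphism (tens_inr k).
Proof.
split=> [x y|]; last by split=> [//|x y]; rewrite /tens_inr pureM mulr1.
apply: (addIr (tens_inr k y)); rewrite subrK -[LHS]pureDr.
by rewrite subrK.
Qed.

Lemma tens_inr_central a (t : tensor k) :
  tens_inr k a * t = t * tens_inr k a.
Proof.
elim/tens_ind: t => [|t u IHt IHu|x b]; first by rewrite mulr0 mul0r.
  by rewrite mulrDl mulrDr IHt IHu.
by rewrite /tens_inr !pureM mulrC mul1r mulr1.
Qed.

Lemma tens_inr_base c : tens_inr k (k c) = tens_inl k (val c).
Proof. by rewrite /tens_inl -[val c]mul1r pureZ mulr1. Qed.

Section Mult.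
Variables (F : pzRingType) (j : H -> F) (iota : f -> F).
Hypotheses (jM : ring_morphism j) (iM : ring_morphism iota).
Hypothesis ij : forall a x, iota a * j x = j x * iota a.
Hypothesis ik : forall c, iota (k c) = j (val c).

Let mul_balanced : balanced k (fun x a => j x * iota a).
Proof.
split=> [a x y|x a b|x c a]; first by rewrite (rmD jM) mulrDl.
- by rewrite (rmD iM) mulrDr.
- by rewrite (rmM jM) (rmM iM) ik mulrA.
Qed.

Definition tens_mult : tensor k -> F := tens_lift (fun x a => j x * iota a).

Lemma tens_mult_pure x a : tens_mult (pure k x a) = j x * iota a.
Proof. exact: (tens_lift_pure mul_balanced). Qed.

Lemma tens_mult_inl x : tens_mult (tens_inl k x) = j x.
Proof. by rewrite tens_mult_pure (rm1 iM) mulr1. Qed.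

Lemma tens_mult_inr a : tens_mult (tens_inr k a) = iota a.
Proof. by rewrite tens_mult_pure (rm1 jM) mul1r. Qed.

Lemma tens_mult_morphism : ring_morphism tens_mult.
Proof.
have mD : {morph tens_mult : t u / t + u} := tens_liftD mul_balanced.
have m0 : tens_mult 0 = 0 := tens_lift0 mul_balanced.
split=> [t u|]; first by apply: (addIr (tens_mult u)); rewrite subrK -mD subrK.
split=> [|t u]; first by rewrite tens_mult_pure (rm1 jM) (rm1 iM) mulr1.
elim/tens_ind: t => [|t t' IHt IHt'|x a].
- by rewrite mul0r m0 mul0r.
- by rewrite mulrDl !mD mulrDl IHt IHt'.
elim/tens_ind: u => [|u u' IHu IHu'|y b].
- by rewrite mulr0 m0 mulr0.
- by rewrite mulrDr !mD mulrDr IHu IHu'.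
rewrite pureM !tens_mult_pure (rmM jM) (rmM iM) -!mulrA; congr (_ * _).
by rewrite !mulrA ij.
Qed.

End Mult.

End Multiplication.

Section TensMap.
Variables (H : nzRingType) (f f' : comPzRingType).
Variables (k : centre H -> f) (k' : centre H -> f') (u : f -> f').
Hypotheses (uM : ring_morphism u) (uk : forall c, u (k c) = k' c).

Let tens_mapE : tens_map k k' u = tens_mult (tens_inl k') (tens_inr k' \o u).
Proof.
congr tens_lift; apply/funext => x; apply/funext => a /=.
by rewrite /tens_inl /tens_inr pureM mulr1 mul1r.
Qed.

Let urM : ring_morphism (tens_inr k' \o u).
Proof. exact: rm_comp uM (tens_inr_morphism k'). Qed.

Let ub (c : centre H) : (tens_inr k' \o u) (k c) = tens_inl k' (val c).
Proof. by rewrite /= uk tens_inr_base. Qed.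

Lemma tens_map_inl x : tens_map k k' u (tens_inl k x) = tens_inl k' x.
Proof. by rewrite tens_mapE (tens_mult_inl (tens_inl_morphism k')). Qed.

Lemma tens_map_inr a : tens_map k k' u (tens_inr k a) = tens_inr k' (u a).
Proof. by rewrite tens_mapE (tens_mult_inr (tens_inl_morphism k')). Qed.

Lemma tens_map_morphism : ring_morphism (tens_map k k' u).
Proof.
rewrite tens_mapE; apply: tens_mult_morphism ub => //.
- exact: tens_inl_morphism.
- by move=> a x; apply: tens_inr_central.
Qed.

End TensMap.

Lemma tens_map_bij (H : nzRingType) (f f' : comPzRingType)
    (k : centre H -> f) (k' : centre H -> f') (u : f -> f') :
  ring_morphism u -> bijective u -> (forall c, u (k c) = k' c) ->
  bijective (tens_map k k' u).
Proof.
move=> uM [v uv vu] uk; have vM := rm_cancel uM uv vu.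
have vk c : v (k' c) = k c by rewrite -uk uv.
have mM := tens_map_morphism uM uk; have nM := tens_map_morphism vM vk.
exists (tens_map k' k v); apply: tens_eq => //; try exact: rm_comp.
- by move=> x /=; rewrite !tens_map_inl.
- by move=> a /=; rewrite !tens_map_inr ?uv.
- by move=> x /=; rewrite !tens_map_inl.
- by move=> a /=; rewrite !tens_map_inr ?vu.
Qed.

(** * Extensions in which the centralizer of the base is central *)

Lemma inj_surj_bij (A : choiceType) (B : Type) (g : A -> B) :
  injective g -> (forall y, exists x, g x = y) -> bijective g.
Proof.
move=> gI /choice[h hE]; exists h => // x.
by apply: gI; rewrite hE.
Qed.

(** [iota] identifies [f] with the centralizer of [j H] in [F], which is required
    to be central.  Keeping [f] abstract covers both the centre of a Galois
    extension and the given field of a tensor product. *)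
Record outer_extension (H F : pzRingType) (f : comPzRingType) (j : H -> F)
    (k : centre H -> f) (iota : f -> F) : Prop := OuterExtension {
  oe_base : ring_morphism j;
  oe_field : ring_morphism k;
  oe_iota : ring_morphism iota;
  oe_base_inj : injective j;
  oe_iota_inj : injective iota;
  oe_central : forall a z, iota a * z = z * iota a;
  oe_balanced : forall c, iota (k c) = j (val c);
  oe_centralizer : forall z, (forall x, j x * z = z * j x) ->
    exists a, z = iota a
}.

Section OuterExtension.
Variables (H : nzRingType) (N : nat) (e : 'I_N -> H).
Hypotheses (Hdiv : division_ring H) (eP : centre_basis e).
Variables (F : pzRingType) (f : comPzRingType).
Variables (j : H -> F) (k : centre H -> f) (iota : f -> F).
Hypothesis sc : outer_extension j k iota.

Let jM := oe_base sc.
Let kM := oe_field sc.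
Let iM := oe_iota sc.
Let iC := oe_central sc.

Let jC (c : centre H) z : j (val c) * z = z * j (val c).
Proof. by rewrite -(oe_balanced sc) iC. Qed.

(* A sandwich operator that computes the l-th coordinate on [H]; [projF l] is
   the same operator on [F].  Its values commute with [H], and they are the
   coordinates of its argument over the centralizer. *)
Let proj l := projT1 (cid (sandwich_coord eP Hdiv l)).
Let projE l x : \sum_m proj l m * x * e m = val (coord eP x l).
Proof. by rewrite /proj; case: cid. Qed.
Let projF l z := \sum_m j (proj l m) * z * j (e m).

Let projF_comm l z y : j y * projF l z = projF l z * j y.
Proof.
rewrite mulr_sumr mulr_suml.
transitivity (\sum_m j (y * proj l m) * z * j (e m)).
  by apply: eq_bigr => m _; rewrite (rmM jM) !mulrA.
rewrite (sandwich_transfer eP Hdiv jM jC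
  (A' := proj l) (B' := fun m => e m * y)) => [|x].
  by apply: eq_bigr => m _; rewrite (rmM jM) !mulrA.
transitivity (y * val (coord eP x l)).
  by rewrite -projE mulr_sumr; apply: eq_bigr => m _; rewrite !mulrA.
rewrite -centre_valC -projE mulr_suml.
by apply: eq_bigr => m _; rewrite !mulrA.
Qed.

Let projF_sum z : z = \sum_l projF l z * j (e l).
Proof.
transitivity (\sum_(i : unit) j 1 * z * j 1).
  by rewrite (big_pred1 tt) => [|[] //]; rewrite (rm1 jM) mul1r mulr1.
rewrite (sandwich_transfer eP Hdiv jM jC (A := fun=> 1) (B := fun=> 1)
  (A' := fun i : 'I_N * 'I_N => proj i.1 i.2)
  (B' := fun i => e i.2 * e i.1)) => [|x].
  rewrite -(pair_bigA _ (fun l m => j (proj l m) * z * j (e m * e l))) /=.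
  apply: eq_bigr => l _; rewrite mulr_suml; apply: eq_bigr => m _.
  by rewrite (rmM jM) mulrA.
rewrite (big_pred1 tt) => [|[] //]; rewrite mul1r mulr1 [LHS](coordE eP).
rewrite -(pair_bigA _ (fun l m => proj l m * x * (e m * e l))) /=.
apply: eq_bigr => l _; rewrite -projE mulr_suml.
by apply: eq_bigr => m _; rewrite mulrA.
Qed.

Let projF_basis (a : 'I_N -> f) m :
  projF m (\sum_l j (e l) * iota (a l)) = iota (a m).
Proof.
rewrite /projF.
transitivity (\sum_l j (val (coord eP (e l) m)) * iota (a l)).
  under [RHS]eq_bigr do rewrite -projE (rm_sum jM) mulr_suml.
  rewrite exchange_big; apply: eq_bigr => b _; rewrite mulr_sumr mulr_suml.
  apply: eq_bigr => l _; rewrite !(rmM jM) -!mulrA; do 2!congr (_ * _).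
  by rewrite iC.
rewrite (bigD1 m) //= big1 ?addr0 => [|l /negbTE lm].
  by rewrite coord_basis eqxx -(oe_balanced sc) (rm1 kM) (rm1 iM) mul1r.
by rewrite coord_basis lm -(oe_balanced sc) (rm0 kM) (rm0 iM) mul0r.
Qed.

(** Together with [oe_free]: the basis [e] of [H] over [h] is also a basis of [F]
    over [f]. *)
Lemma oe_span z : exists a, z = \sum_l j (e l) * iota (a l).
Proof.
have /choice[a aE] l := oe_centralizer sc (projF_comm l z).
exists a; rewrite {1}[z]projF_sum; apply: eq_bigr => l _.
by rewrite aE iC.
Qed.

Lemma oe_free a b :
  \sum_l j (e l) * iota (a l) = \sum_l j (e l) * iota (b l) -> a =1 b.
Proof.
by move=> ab m; apply: (oe_iota_inj sc); rewrite -!projF_basis ab.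
Qed.

Lemma oe_eq (F' : pzRingType) (g g' : F -> F') :
  ring_morphism g -> ring_morphism g' ->
  (forall x, g (j x) = g' (j x)) -> (forall a, g (iota a) = g' (iota a)) ->
  g =1 g'.
Proof.
move=> gM g'M gj gi z; have [a ->] := oe_span z.
rewrite (rm_sum gM) (rm_sum g'M); apply: eq_bigr => l _.
by rewrite (rmM gM) (rmM g'M) gj gi.
Qed.

Let mult := tens_mult (k := k) j iota.

Lemma oe_mult_morphism : ring_morphism mult.
Proof. by apply: tens_mult_morphism (oe_balanced sc) => // a x; exact: iC. Qed.

Lemma oe_mult_inl x : mult (tens_inl k x) = j x.
Proof. exact: (tens_mult_inl jM iM (oe_balanced sc)). Qed.

Lemma oe_mult_inr a : mult (tens_inr k a) = iota a.
Proof. exact: (tens_mult_inr jM iM (oe_balanced sc)). Qed.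

Lemma oe_mult_bij : bijective mult.
Proof.
have multE t : mult t = \sum_l j (e l) * iota (tcoord eP l t).
  rewrite {1}(tensorE eP kM t) (rm_sum oe_mult_morphism).
  by apply: eq_bigr => l _; rewrite -(tens_mult_pure jM iM (oe_balanced sc)).
apply/inj_surj_bij => [t u|z].
  rewrite !multE => /oe_free tu; rewrite (tensorE eP kM t) (tensorE eP kM u).
  by apply: eq_bigr => l _; rewrite tu.
have [a ->] := oe_span z; exists (\sum_l pure k (e l) (a l)).
by rewrite multE; apply: eq_bigr => l _; rewrite (tcoord_sum eP kM).
Qed.

(** An automorphism that fixes [H] pointwise preserves its centralizer. *)
Lemma oe_restricts (s : gal j) : exists t : gal k, restricts iota s t.
Proof.
have ex (s' : gal j) : exists t : f -> f, forall a, s' (iota a) = iota (t a).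
  have /choice[t tE] a : exists b, s' (iota a) = iota b; last by exists t.
  apply: (oe_centralizer sc) => x; rewrite -(gal_fix s' x).
  have s'M := gal_morph s'; rewrite -!(rmM s'M); congr (gal_val s' _).
  by rewrite iC.
have [t tE] := ex s; have [t' t'E] := ex (s^-1)%g.
have iI := oe_iota_inj sc; have sM := gal_morph s.
have tt' : cancel t t'.
  by move=> a; apply: iI; rewrite -t'E -tE -[LHS]/((s^-1 * s)%g _) mulVg.
have t't : cancel t' t.
  by move=> a; apply: iI; rewrite -tE -t'E -[LHS]/((s * s^-1)%g _) mulgV.
have tM : ring_morphism t.
  split=> [a b|]; first by apply: iI; rewrite -tE !(rmB iM) (rmB sM) !tE.
  split=> [|a b]; apply: iI; rewrite -tE; first by rewrite (rm1 iM) (rm1 sM).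
  by rewrite !(rmM iM) (rmM sM) !tE.
have tf c : t (k c) = k c by apply: iI; rewrite -tE (oe_balanced sc) gal_fix.
by exists (Gal tM (Bijective tt' t't) tf).
Qed.

Lemma resE (s : gal j) a : s (iota a) = iota ((res iota s : gal k) a).
Proof. by have := xgetPex (1%g : gal k) (oe_restricts s); apply. Qed.

Lemma res_unique (s : gal j) (t : gal k) :
  (forall a, s (iota a) = iota (t a)) -> res iota s = t.
Proof. by move=> st; apply: galP => a; apply: (oe_iota_inj sc); rewrite -resE. Qed.

Lemma resM : {morph (res iota : gal j -> gal k) : s t / (s * t)%g}.
Proof. by move=> s t; apply: res_unique => a; rewrite /= !resE. Qed.

(** Injective because [H] and [f] generate [F]; surjective because an
    automorphism of [f] over [h] extends to the tensor product by acting on the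
    second factor. *)
Lemma res_bij : bijective (res iota : gal j -> gal k).
Proof.
apply/inj_surj_bij => [s s' ss'|t].
  apply: galP; apply: oe_eq => [||x|a]; try exact: gal_morph.
    by rewrite !gal_fix.
  by rewrite !resE ss'.
have [m multK mK] := oe_mult_bij.
have mM := rm_cancel oe_mult_morphism multK mK.
have tM := tens_map_morphism (gal_morph t) (gal_fix t).
have sM := rm_comp (rm_comp mM tM) oe_mult_morphism.
have sB : bijective (mult \o (tens_map k k t \o m)).
  apply: bij_comp oe_mult_bij _; apply: bij_comp; last by exists mult.
  exact: tens_map_bij (gal_morph t) (gal_bij t) (gal_fix t).
have sj x : (mult \o (tens_map k k t \o m)) (j x) = j x.
  rewrite /= -oe_mult_inl multK (tens_map_inl (gal_morph t) (gal_fix t)).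
  by [].
exists (Gal sM sB sj); apply: res_unique => a /=.
rewrite -[iota a]oe_mult_inr multK (tens_map_inr (gal_morph t) (gal_fix t)).
by rewrite oe_mult_inr.
Qed.

(** From [f/h] to [F/H]: the automorphisms of [F] act on coordinates in the
    basis [e], so a fixed element has coordinates in [h]. *)
Lemma oe_galois : galois j <-> galois k.
Proof.
split=> [gj a afix|gk z zfix].
  have [|y ay] := gj (iota a).
    by move=> s; rewrite resE afix.
  have yC : y \in @central H.
    apply/centralP => x; apply: (oe_base_inj sc).
    by rewrite !(rmM jM) -ay iC.
  by exists (Centre yC); apply: (oe_iota_inj sc); rewrite (oe_balanced sc).
have [a zE] := oe_span z.
have /choice[c cE] l : exists c, a l = k c.
  apply: gk => t; move: l; apply: oe_free.
  have [r _ rK] := res_bij; have sM := gal_morph (r t).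
  rewrite -zE -[in RHS](zfix (r t)) zE (rm_sum sM); apply: eq_bigr => l _.
  by rewrite (rmM sM) gal_fix resE rK.
exists (\sum_l e l * val (c l)); rewrite zE (rm_sum jM).
by apply: eq_bigr => l _; rewrite (rmM jM) cE (oe_balanced sc).
Qed.

End OuterExtension.

(** * Galois extensions with finite group *)

Definition finite_type (T : choiceType) : Prop :=
  exists s : seq T, forall x, x \in s.

Lemma finite_inj (A B : choiceType) (g : A -> B) (a0 : A) :
  injective g -> (exists s : seq B, forall x, g x \in s) -> finite_type A.
Proof.
move=> gI [s sP]; exists (map (inverse_fun a0 g) s) => x.
apply/mapP; exists (g x) => //; apply: gI; rewrite /inverse_fun.
by case: xgetP => [y _ /= -> //|/(_ x) []].
Qed.

Lemma finite_families (A B : choiceType) (m : nat) (g : ('I_m -> A) -> B) :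
  (forall b, exists a, b = g a) -> finite_type A -> finite_type B.
Proof.
move=> gS [s sP].
exists [seq g (fun i => tnth (in_tuple s) (r i)) |
        r : {ffun 'I_m -> 'I_(size s)}] => b.
have [a ->] := gS b; apply/mapP.
have /choice[r rE] i : exists l, a i = tnth (in_tuple s) l.
  by apply/(tnthP (in_tuple s)).
exists [ffun i => r i]; rewrite ?mem_enum //; congr g; apply/funext => i.
by rewrite ffunE rE.
Qed.

(** Wedderburn's little theorem, for a bare ring given with a list of its
    elements. *)
Lemma wedderburn (R : pzRingType) :
  division_ring R -> finite_type R -> forall x y : R, x * y = y * x.
Proof.
move=> [R1 inv] [s sP].
pose nz := GRing.PzSemiRing_isNonZero.Build R R1.
pose RN : nzRingType := HB.pack R nz.
pose iv (x : R) := xget (0 : R) [set y | x * y = 1 /\ y * x = 1]%classic.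
have ivE (x : R) : x != 0 -> x * iv x = 1 /\ iv x * x = 1.
  by move=> /inv /(@xgetPex R 0).
pose U := [pred x : RN | x != 0].
have mulVx : {in U, left_inverse 1 iv ( *%R : RN -> RN -> RN)}.
  by move=> x; rewrite inE => /ivE [].
have mulxV : {in U, right_inverse 1 iv ( *%R : RN -> RN -> RN)}.
  by move=> x; rewrite inE => /ivE [].
have unitP (x y : RN) : y * x = 1 /\ x * y = 1 -> x \in U.
  move=> [yx _]; rewrite inE; apply: contraNneq (R1) => x0.
  by rewrite -[1]yx x0 mulr0.
have ivout : {in [predC U], iv =1 id}.
  move=> x; rewrite inE /= inE negbK => /eqP ->.
  rewrite /iv; case: xgetP => // y _ [].
  by rewrite mul0r => /esym/eqP; rewrite (negbTE R1).
pose un := GRing.NzRing_hasMulInverse.Build RN mulVx mulxV unitP ivout.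
pose RU : unitRingType := HB.pack RN un.
have pK : pcancel (index^~ (undup s) : R -> nat) (fun i => onth (undup s) i).
  move=> x; rewrite /= (onthE (undup s)) (nth_map x) ?nth_index ?mem_undup //.
  by rewrite index_mem mem_undup.
pose ct := isCountable.Build R pK.
have fa : Finite.axiom (undup s).
  by move=> x; rewrite count_uniq_mem ?undup_uniq // mem_undup sP.
pose RC : countType := HB.pack R ct.
pose fin := isFinite.Build RC fa.
pose RF : finUnitRingType := HB.pack R RU ct fin.
have dom : GRing.integral_domain_axiom RF.
  move=> x y xy; case: (eqVneq x 0) => //= /ivE [_ ix].
  by rewrite -[y]mul1r -[1]ix -mulrA [X in _ * X]xy mulr0.
exact: (finfield.finDomain_mulrC dom).
Qed.

(** Elimination with left coefficients; [i0] is the pivot of the last row. *)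
Lemma underdetermined (D : pzRingType) m (A : 'I_m -> 'I_m.+1 -> D) :
  division_ring D -> exists x : 'I_m.+1 -> D,
    (exists i, x i != 0) /\ forall l, \sum_i x i * A l i = 0.
Proof.
move=> [D1 inv]; elim: m A => [|m IHm] A.
  by exists (fun=> 1); split=> [|[]//]; exists ord0.
have [|/existsNP[i0 /eqP /inv [b [Ab bA]]]] :=
    pselect (forall i, A ord_max i = 0).
  move=> A0.
  have [x [[i xi] xA]] := IHm (fun l i => A (lift ord_max l) (lift ord0 i)).
  exists (fun i => if unlift ord0 i is Some i' then x i' else 0).
  split=> [|l]; first by exists (lift ord0 i); rewrite liftK.
  rewrite big_ord_recl unlift_none mul0r add0r.
  case: (unliftP ord_max l) => [l'|] ->; last first.
    by rewrite big1 // => i' _; rewrite A0 mulr0.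
  by under eq_bigr do rewrite liftK; apply: xA.
have [x [[i xi] xA]] := IHm (fun l i => A (lift ord_max l) (lift i0 i) -
  A ord_max (lift i0 i) * b * A (lift ord_max l) i0).
pose x0 := - \sum_i x i * A ord_max (lift i0 i) * b.
exists (fun i => if unlift i0 i is Some i' then x i' else x0).
split=> [|l]; first by exists (lift i0 i); rewrite liftK.
rewrite (bigD1_ord i0) //= unlift_none; under eq_bigr do rewrite liftK.
rewrite /x0 mulNr mulr_suml addrC; apply/eqP; rewrite subr_eq0; apply/eqP.
case: (unliftP ord_max l) => [l'|] ->; last first.
  by apply: eq_bigr => i' _; rewrite -[in RHS]mulrA bA mulr1.
apply/eqP; rewrite -subr_eq0 -sumrB; apply/eqP; rewrite -[RHS](xA l').
by apply: eq_bigr => i' _; rewrite mulrBr !mulrA.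
Qed.

Section Artin.
Variables (H F : pzRingType) (j : H -> F) (s : seq (gal j)).
Hypotheses (Fdiv : division_ring F) (jM : ring_morphism j) (gj : galois j).
Hypothesis sP : forall sigma, sigma \in s.

(** Artin's argument.  The equations [sum_i x_i sigma(z_i) = 0] are fewer than
    their unknowns, so they have a nonzero solution in [F].  If it has minimal
    support and one of its entries is 1, then [tau x - x] is a solution of
    smaller support for every [tau], so [x] is fixed by the Galois group. *)
Lemma artin_dependent (z : 'I_(size s).+1 -> F) :
  exists c : 'I_(size s).+1 -> H,
    (exists i, c i != 0) /\ \sum_i j (c i) * z i = 0.
Proof.
pose sol (x : 'I_(size s).+1 -> F) :=
  forall sigma : gal j, \sum_i x i * sigma (z i) = 0.
suff fixed r (x : 'I_(size s).+1 -> F) : (#|[pred i | x i != 0%R]| < r)%N ->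
    sol x -> (exists i, x i != 0) ->
    exists c : 'I_(size s).+1 -> H, (exists i, c i != 0) /\ sol (j \o c).
  have [x [x0 xA]] := underdetermined
    (fun l i => tnth (in_tuple s) l (z i)) Fdiv.
  have [|c [c0 csol]] := fixed _ x (ltnSn _) _ x0.
    by move=> sigma; have /(tnthP (in_tuple s))[l ->] := sP sigma; apply: xA.
  by exists c; split=> //; apply: (csol 1%g).
elim: r x => // r IHr x xr xsol [i0 xi0].
have [y [xy yx]] := Fdiv.2 _ xi0.
pose x1 i := y * x i.
have x1sol : sol x1.
  move=> sigma; under eq_bigr do rewrite -mulrA.
  by rewrite -mulr_sumr xsol mulr0.
have [fix1|/existsNP[tau /existsNP[i1 /eqP ti1]]] :=
    pselect (forall (tau : gal j) i, tau (x1 i) = x1 i).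
  have /choice[c cE] i : exists c, x1 i = j c by apply: gj => tau.
  exists c; split; last by move=> sigma /=; under eq_bigr do rewrite -cE.
  exists i0; apply: contraNneq (Fdiv.1) => c0.
  by rewrite -[1]yx -/(x1 i0) cE c0 (rm0 jM).
apply: (IHr (fun i => tau (x1 i) - x1 i)); last first.
- by exists i1; rewrite subr_eq0.
- move=> sigma; have tM := gal_morph tau.
  under eq_bigr do rewrite mulrBl; rewrite sumrB x1sol subr0.
  rewrite -[RHS](rm0 tM) -[in RHS](x1sol (tau^-1 * sigma)%g) (rm_sum tM).
  apply: eq_bigr => i _; rewrite (rmM tM); congr (_ * _).
  by rewrite -[RHS]/((tau * (tau^-1 * sigma))%g _) mulKVg.
rewrite ltnS in xr; apply: (leq_trans _ xr); apply: proper_card.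
apply/properP; split.
  apply/fintype.subsetP => i; rewrite !inE; apply: contraNneq => xi.
  by rewrite /x1 xi mulr0 (rm0 (gal_morph tau)) subrr.
exists i0; rewrite !inE ?xi0 // /x1 yx (rm1 (gal_morph tau)).
by rewrite subrr eqxx.
Qed.

(** By [artin_dependent], [F] is spanned over [H] by a maximal free family. *)
Lemma artin_finite : division_ring H -> finite_type H -> finite_type F.
Proof.
move=> Hdiv Hfin.
pose indep m := exists z : 'I_m -> F,
  forall c : 'I_m -> H, \sum_i j (c i) * z i = 0 -> forall i, c i = 0.
have [m [[z zfree] maxm]] : exists m, indep m /\ ~ indep m.+1.
  apply: contrapT => /forallNP maxm.
  have all_indep m : indep m.
    elim: m => [|m IHm]; first by exists (fun=> 0) => c _ [].
    by apply: contrapT => nm; apply: (maxm m).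
  have [z zfree] := all_indep (size s).+1.
  have [c [[i ci] c0]] := artin_dependent z.
  by rewrite (zfree c c0) eqxx in ci.
apply: (finite_families (m := m) (g := fun a => \sum_i j (a i) * z i)) Hfin.
move=> w; apply: contrapT => wspan; apply: maxm.
exists (fun i => if unlift ord0 i is Some i' then z i' else w) => c.
rewrite big_ord_recl unlift_none; under eq_bigr do rewrite liftK.
move=> c0; case: (eqVneq (c ord0) 0) => [c00|].
  move=> i; case: (unliftP ord0 i) => [i'|] -> //.
  apply: (zfree (fun i => c (lift ord0 i))).
  by move: c0; rewrite c00 (rm0 jM) mul0r add0r.
move=> /(Hdiv.2)[y [_ yc]]; case: wspan.
exists (fun i => - (y * c (lift ord0 i))).
move/eqP: c0; rewrite addrC addr_eq0 => /eqP c0.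
under eq_bigr do rewrite (rmN jM) (rmM jM) mulNr -mulrA.
by rewrite sumrN -mulr_sumr c0 mulrN opprK mulrA -(rmM jM) yc (rm1 jM) mul1r.
Qed.

End Artin.

Section Centralizer.
Variables (H F : pzRingType) (j : H -> F).
Hypotheses (Fdiv : division_ring F) (jM : ring_morphism j).

Lemma inner_gal v : v != 0 -> (forall x, j x * v = v * j x) ->
  exists sigma : gal j, forall z, sigma z * v = v * z.
Proof.
move=> /(Fdiv.2)[u [vu uv]] vj.
have conjK (a b : F) : a * b = 1 -> b * a = 1 ->
    cancel (fun z => a * z * b) (fun z => b * z * a).
  by move=> ab ba z; rewrite !mulrA ba mul1r -mulrA ba mulr1.
have cM : ring_morphism (fun z => v * z * u).
  split=> [x y|]; first by rewrite mulrBr mulrBl.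
  split=> [|x y]; first by rewrite mulr1.
  by rewrite !mulrA -[v * x * u * v]mulrA uv mulr1.
have cf x : v * j x * u = j x by rewrite -vj -mulrA vu mulr1.
exists (Gal cM (Bijective (conjK _ _ vu uv) (conjK _ _ uv vu)) cf) => z /=.
by rewrite -mulrA uv mulr1.
Qed.

Hypotheses (Hdiv : division_ring H) (gj : galois j).
Hypothesis galfin : finite_type (gal j).
Variables (N : nat) (e : 'I_N -> H).
Hypothesis eP : forall x, exists c : 'I_N -> centre H, x = \sum_i val (c i) * e i.

(** Conjugation embeds the nonzero elements of the centralizer, modulo those of
    the centre of [F], in the finite group of [F/H].  If some [w] in the
    centralizer is not central, distinct [a] in the centre give distinct
    conjugations by [w + a], so the centre is finite; then so are, successively,
    the centralizer, [h], which lies in it, [H] and [F], and [F] is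
    commutative. *)
Lemma centralizer_central w : (forall x, j x * w = w * j x) -> w \in @central F.
Proof.
move=> wj; apply: contrapT => /negP wC.
have jI : injective j := rm_inj jM Hdiv Fdiv.1.
have Ffin : finite_type (centre F).
  have w_shift (a : centre F) : exists sigma : gal j,
      forall z, sigma z * (w + val a) = (w + val a) * z.
    apply: inner_gal => [|x]; last by rewrite mulrDl mulrDr wj centre_valC.
    apply: contraNneq wC => /eqP; rewrite addr_eq0 => /eqP ->.
    by apply/centralP => z; rewrite mulNr mulrN centre_valC.
  have /choice[g gE] := w_shift.
  apply: (finite_inj (g := g) 0) => [a b ab|]; last first.
    by have [s sP] := galfin; exists s.
  apply: contrapT => /eqP; rewrite -subr_eq0.
  move=> /(centre_division Fdiv).2[c [abc _]]; case/negP: wC.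
  have gz z : g a z = z.
    have := congr2 (fun x y => x - y) (gE a z) (gE b z).
    rewrite -ab -mulrBr -mulrBl opprD addrACA subrr add0r.
    rewrite -[val a - val b]/(val (a - b)) centre_valC.
    move=> /(congr1 ( *%R^~ (val c))).
    rewrite -!mulrA -![val (a - b) * val c]/(val ((a - b) * c)) abc !mulr1.
    by [].
  apply/centralP => z; have := gE a z.
  by rewrite gz mulrDl mulrDr centre_valC => /addIr ->.
have Cfin : exists s : seq F, forall v, (forall x, j x * v = v * j x) -> v \in s.
  have [sg sgP] := galfin; have [sf sfP] := Ffin.
  (* Some nonzero element inducing [sigma] by conjugation, if there is one. *)
  pose r (sigma : gal j) := xget (0 : F)
    [set v | v != 0 /\ forall z, sigma z * v = v * z]%classic.
  exists (0 :: [seq r sigma * val u | sigma <- sg, u <- sf]) => v vj.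
  rewrite inE; case: (eqVneq v 0) => //= v0.
  have [sigma sv] := inner_gal v0 vj.
  have [/(Fdiv.2)[q [rq qr]] sr] := @xgetPex F 0
    [set v | v != 0 /\ forall z, sigma z * v = v * z]%classic
    (ex_intro _ v (conj v0 sv)).
  rewrite -/(r sigma) in rq qr sr.
  have uC : q * v \in @central F.
    apply/centralP => z.
    rewrite -mulrA -sv -[sigma z]mulr1 -rq !mulrA -[q * _ * _]mulrA sr.
    by rewrite mulrA qr mul1r -mulrA.
  apply/allpairsP; exists (sigma, Centre uC); split=> //=.
  by rewrite mulrA rq mul1r.
have Hfin : finite_type H.
  apply: (finite_families (m := N) (A := centre H)
    (g := fun c => \sum_i val (c i) * e i)) => //.
  apply: (finite_inj (g := fun c : centre H => j (val c)) 0).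
    by move=> c c' /jI /val_inj.
  have [s sP] := Cfin; exists s => c; apply: sP => x.
  by rewrite -!(rmM jM) centre_valC.
case/negP: wC; apply/centralP.
have [sg sgP] := galfin.
exact: (wedderburn Fdiv (artin_finite Fdiv jM gj sgP Hdiv Hfin)).
Qed.

End Centralizer.

(** * The two sources of outer extensions *)

Lemma inverse_funK (A : choiceType) (B : Type) (d : A) (g : A -> B) :
  bijective g -> cancel g (inverse_fun d g) /\ cancel (inverse_fun d g) g.
Proof.
move=> [h gh hg].
have E y : g (inverse_fun d g y) = y.
  by rewrite /inverse_fun; case: xgetP => [x _ //|/(_ (h y)) []]; apply: hg.
by split=> // x; apply: (can_inj gh); rewrite E.
Qed.

Lemma centre_mapE (K L : pzRingType) (j : K -> L) c :
  j (val c) \in @central L -> centre_val (centre_map j c) = j (val c).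
Proof. by move=> jc; apply: (insubdK 0 jc). Qed.

Lemma centre_map_morphism (K L : pzRingType) (j : K -> L) :
  ring_morphism j -> (forall c : centre K, j (val c) \in @central L) ->
  ring_morphism (centre_map j).
Proof.
move=> jM jc; have E c := centre_mapE (jc c).
split=> [x y|]; first by apply: val_inj; rewrite /= E !raddfB !E (rmB jM).
split=> [|x y]; apply: val_inj; rewrite /= E; first exact: (rm1 jM).
by rewrite !E (rmM jM).
Qed.

Lemma gal_finite (K L : pzRingType) (j : K -> L) (G : finType)
    (g : G -> gal j) : (forall s, exists x, g x = s) -> finite_type (gal j).
Proof.
move=> gS; exists [seq g x | x <- enum G] => s.
by apply/mapP; have [x <-] := gS s; exists x; rewrite ?mem_enum.
Qed.

Section Instances.
Variables (H : nzRingType) (N : nat) (e : 'I_N -> H).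
Hypotheses (Hdiv : division_ring H) (eP : centre_basis e).

Lemma galois_outer (F : pzRingType) (j : H -> F) :
  division_ring F -> ring_morphism j -> galois j -> finite_type (gal j) ->
  outer_extension j (centre_map j) (@centre_val F).
Proof.
move=> Fdiv jM gj jfin.
have cent z : (forall x, j x * z = z * j x) -> z \in @central F.
  apply: (centralizer_central Fdiv jM Hdiv gj jfin (e := e)) => x.
  by have [c [cE _]] := eP x; exists c.
have jc (c : centre H) : j (val c) \in @central F.
  by apply: cent => x; rewrite -!(rmM jM) centre_valC.
split=> //.
- exact: centre_map_morphism.
- exact: rm_inj Fdiv.1.
- exact: val_inj.
- by move=> a z; apply: centre_valC.
- by move=> c; rewrite centre_mapE.
- by move=> z /cent zc; exists (Centre zc).
Qed.

(** If [t] commutes with [H], a sandwich operator that computes a coordinate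
    multiplies [t] by the corresponding coordinate [c] of 1, and it maps the
    tensor product to [f].  Choose the coordinate with [c] nonzero. *)
Lemma tensor_outer (f : comPzRingType) (k : centre H -> f) :
  division_ring f -> ring_morphism k -> division_ring (tensor k) ->
  outer_extension (tens_inl k) k (tens_inr k).
Proof.
move=> fdiv kM Tdiv.
have lM := tens_inl_morphism k; have rM := tens_inr_morphism k.
have bal := tens_inr_base k.
split=> //.
- exact: rm_inj Tdiv.1.
- exact: rm_inj Tdiv.1.
- exact: tens_inr_central.
move=> t tC.
have [l /eqP c0] : exists l, coord eP 1 l <> 0.
  apply: contrapT => /forallNP c0; case/eqP: (oner_neq0 H).
  rewrite (coordE eP 1) big1 // => l _.
  by have /contrapT -> := c0 l; rewrite mul0r.
have [p pE] := sandwich_coord eP Hdiv l.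
have kc0 : k (coord eP 1 l) != 0.
  apply: contraNneq c0 => kc0; apply/eqP.
  by apply: (rm_inj kM (centre_division Hdiv) fdiv.1); rewrite kc0 (rm0 kM).
have [b [_ bc]] := fdiv.2 _ kc0.
have st a : \sum_m tens_inl k (p m) * (tens_inl k a * t) * tens_inl k (e m) =
    tens_inl k (val (coord eP a l)) * t.
  rewrite -pE (rm_sum lM) mulr_suml; apply: eq_bigr => m _.
  by rewrite !(rmM lM) -!mulrA tC.
have sp x a : \sum_m tens_inl k (p m) * pure k x a * tens_inl k (e m) =
    tens_inr k (k (coord eP x l) * a).
  rewrite (rmM rM) bal -pE (rm_sum lM) mulr_suml; apply: eq_bigr => m _.
  by rewrite /tens_inl /tens_inr !pureM !(mulr1, mul1r).
exists (b * \sum_m (k (coord eP (e m) l) * tcoord eP m t)).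
rewrite (rmM rM) (rm_sum rM).
rewrite (_ : \sum_m _ = tens_inr k (k (coord eP 1 l)) * t).
  by rewrite mulrA -(rmM rM) bc (rm1 rM) mul1r.
rewrite bal -st (rm1 lM) mul1r [in RHS](tensorE eP kM t).
under [RHS]eq_bigr do rewrite mulr_sumr mulr_suml.
by rewrite exchange_big; apply: eq_bigr => m _; rewrite -sp.
Qed.

End Instances.

(** * The correspondence between solutions *)

Section Correspondence.
Variables (H : nzRingType) (n : nat) (e : 'I_(n ^ 2) -> H).
Variables (FH : {mpoly (centre H)[n ^ 2]}) (L : pzRingType) (i : H -> L).
Variables (G : finGroupType) (alpha : G -> gal i).
Hypotheses (Hdiv : division_ring H) (eP : centre_basis e).
Hypotheses (FHP : reduced_norm_form e FH) (alphaP : embedding_problem alpha).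

Let scL : outer_extension i (centre_map i) (@centre_val L).
Proof.
case: alphaP => Ldiv iM gi _ aS.
exact: (galois_outer Hdiv eP) (gal_finite aS).
Qed.

Lemma check_problemE g (c : centre L) :
  alpha g (centre_val c) = centre_val (check_problem alpha g c).
Proof. exact: (resE scL). Qed.

Lemma check_problem_embedding : embedding_problem (check_problem alpha).
Proof.
case: alphaP => Ldiv iM gi aM aS; split.
- exact: centre_division.
- exact: (oe_field scL).
- exact: (oe_galois Hdiv eP scL).1.
- by move=> x y; rewrite /check_problem /= aM (resM scL).
move=> s; have [r _ rK] := res_bij Hdiv eP scL.
by have [g gE] := aS (r s); exists g; rewrite /check_problem /= gE rK.
Qed.

Section Check.
Variables (F : pzRingType) (beta : solution_data H L F G).
Hypothesis bP : solution alpha beta.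

Lemma solution_outer :
  outer_extension (sol_base beta) (centre_map (sol_base beta)) (@centre_val F).
Proof.
case: bP => Fdiv [jM _ _] gj [_ [b' bK _]] _.
apply: (galois_outer Hdiv eP) => //.
by apply: (gal_finite (g := b')) => s; exists (beta s).
Qed.

(** The image of the centre of [L] commutes with [H], so it lies in the
    centralizer of [H], which is the centre of [F]. *)
Lemma sol_emb_central (c : centre L) : sol_emb beta (val c) \in @central F.
Proof.
case: bP => Fdiv [jM uM ju] _ _ _.
have [z|a ->] := oe_centralizer solution_outer (z := sol_emb beta (val c)).
  by rewrite ju /= -!(rmM uM) centre_valC.
by apply/centralP => y; apply: centre_valC.
Qed.

Lemma sol_embE (c : centre L) :
  centre_val (centre_map (sol_emb beta) c) = sol_emb beta (val c).
Proof. exact: centre_mapE (sol_emb_central c). Qed.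

(** The restriction to the centre is a bijection, so [check] can be evaluated
    without the inverse that defines it. *)
Lemma checkE s : check beta (res (@centre_val F) s) = beta s.
Proof.
by rewrite /check /= (inverse_funK _ (res_bij Hdiv eP solution_outer)).1.
Qed.

Lemma check_solution :
  solution (check_problem alpha) (check beta) /\
  only_trivial_zero (sol_base (check beta)) FH.
Proof.
case: (bP) => Fdiv [jM uM ju] gj [bM bB] bR; have sc := solution_outer.
have rB := res_bij Hdiv eP sc; have [r rK Kr] := rB.
split; last first.
  apply/(trivial_zero_tensor Hdiv eP FHP (centre_division Fdiv) (oe_field sc)).
  have mM := oe_mult_morphism sc; have [m mK Km] := oe_mult_bij Hdiv eP sc.
  split=> [|t t0].
    by apply: contraNneq (Fdiv.1) => T1; rewrite -(rm1 mM) T1 (rm0 mM).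
  have [|y [ty yt]] := Fdiv.2 (tens_mult (sol_base beta) (@centre_val F) t).
    by apply: contraNneq t0 => t0; rewrite -[t]mK t0 -(rm0 mM) mK.
  exists (m y); split; apply: (can_inj mK); rewrite (rmM mM) Km ?ty ?yt.
    by rewrite (rm1 mM).
  by rewrite (rm1 mM).
split.
- exact: centre_division.
- split; first exact: (oe_field sc).
    exact: centre_map_morphism uM sol_emb_central.
  move=> c; apply: val_inj; rewrite /= -[LHS]/(centre_val _) -[RHS]/(centre_val _).
  rewrite sol_embE -[val (centre_map i c)]/(centre_val _) (oe_balanced scL).
  by rewrite (oe_balanced sc) ju.
- exact: (oe_galois Hdiv eP sc).1.
- split=> [s t|]; last first.
    apply: bij_comp bB _; exists (res (@centre_val F)).
      exact: (inverse_funK _ rB).2.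
    exact: (inverse_funK _ rB).1.
  by rewrite -(Kr s) -(Kr t) -(resM sc) !checkE bM.
move=> s c; rewrite -(Kr s) checkE; apply: val_inj.
rewrite -[LHS]/(centre_val _) -[RHS]/(centre_val _) -(resE sc) !sol_embE.
by rewrite bR -[val c]/(centre_val c) check_problemE.
Qed.

End Check.

Lemma check_identifies (F F' : pzRingType) (beta : solution_data H L F G)
    (beta' : solution_data H L F' G) (u : F -> F') :
  solution alpha beta -> solution alpha beta' -> identifies beta beta' u ->
  identifies (check beta) (check beta') (centre_map u).
Proof.
move=> bP bP' [uM [v uv vu] uj ue ub].
have sc := solution_outer bP; have sc' := solution_outer bP'.
have uc (c : centre F) : u (val c) \in @central F'.
  apply/centralP => y; rewrite -(vu y) -!(rmM uM).
  by rewrite centre_valC.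
have vM := rm_cancel uM uv vu.
have vc (c : centre F') : v (val c) \in @central F.
  apply/centralP => y; rewrite -(uv y) -!(rmM vM).
  by rewrite centre_valC.
have cuE := fun c => centre_mapE (uc c); have cvE := fun c => centre_mapE (vc c).
split.
- exact: centre_map_morphism.
- exists (centre_map v) => c; apply: val_inj; rewrite /= -[LHS]/(centre_val _).
    by rewrite cvE -[val (centre_map u c)]/(centre_val _) cuE uv.
  by rewrite cuE -[val (centre_map v c)]/(centre_val _) cvE vu.
- move=> c; apply: val_inj; rewrite /= -[LHS]/(centre_val _) -[RHS]/(centre_val _).
  rewrite cuE -[val (centre_map _ c)]/(centre_val _).
  by rewrite (oe_balanced sc) (oe_balanced sc') -uj.
- move=> c; apply: val_inj; rewrite /= -[LHS]/(centre_val _) -[RHS]/(centre_val _).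
  rewrite cuE -[val (centre_map _ c)]/(centre_val _).
  by rewrite !sol_embE // -ue.
have [r _ Kr] := res_bij Hdiv eP sc; have [r' _ Kr'] := res_bij Hdiv eP sc'.
move=> s t; rewrite -(Kr s) -(Kr' t) !checkE // => st; apply: ub.
have sM := gal_morph (r s); have tM := gal_morph (r' t).
apply: (oe_eq Hdiv eP sc (g := u \o r s) (g' := r' t \o u)) => [||x|c] /=.
- exact: rm_comp.
- exact: rm_comp.
- by rewrite gal_fix -[u (sol_base _ x)]/((u \o _) x) uj gal_fix.
rewrite (resE sc) -[centre_val (res _ _ c)]/(val _) -cuE st.
by rewrite -(resE sc') cuE.
Qed.

Let mL := tens_mult (k := centre_map i) i (@centre_val L).

Let mLK : cancel mL (inverse_fun 0 (mult_map i)) /\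
  cancel (inverse_fun 0 (mult_map i)) mL.
Proof. exact: (inverse_funK 0 (oe_mult_bij Hdiv eP scL)). Qed.

Section Hat.
Variables (f : comPzRingType) (gamma : solution_data (centre H) (centre L) f G).
Hypothesis gP : solution (check_problem alpha) gamma.

Let k := sol_base gamma.
Let v := sol_emb gamma.

Lemma hat_embM : ring_morphism (sol_emb (hat i gamma)).
Proof.
case: gP => fdiv [kM vM kv] _ _ _.
apply: rm_comp (rm_cancel (oe_mult_morphism scL) mLK.1 mLK.2) _.
exact: tens_map_morphism vM (fsym kv).
Qed.

(** With [hat_emb_centre], these values determine the embedding of [L], since
    [H] and the centre of [L] generate [L]. *)
Lemma hat_emb_base x : sol_emb (hat i gamma) (i x) = tens_inl k x.
Proof.
case: gP => fdiv [kM vM kv] _ _ _.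
rewrite /= -(oe_mult_inl scL) mLK.1.
by rewrite (tens_map_inl vM (fsym kv)).
Qed.

Lemma hat_emb_centre c : sol_emb (hat i gamma) (centre_val c) = tens_inr k (v c).
Proof.
case: gP => fdiv [kM vM kv] _ _ _.
rewrite /= -(oe_mult_inr scL) mLK.1.
by rewrite (tens_map_inr vM (fsym kv)).
Qed.

Hypothesis triv : only_trivial_zero k FH.

Lemma tensor_division : division_ring (tensor k).
Proof.
case: gP => fdiv [kM _ _] _ _ _.
exact: (trivial_zero_tensor Hdiv eP FHP fdiv kM).1.
Qed.

Lemma hat_outer : outer_extension (tens_inl k) k (tens_inr k).
Proof.
case: gP => fdiv [kM _ _] _ _ _.
exact: (tensor_outer Hdiv eP) tensor_division.
Qed.

Lemma hat_solution : solution alpha (hat i gamma).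
Proof.
case: gP => fdiv [kM vM kv] gk [gM gB] gR; have sc := hat_outer.
have eM := hat_embM; split.
- exact: tensor_division.
- split=> //; first exact: (oe_base sc).
  by move=> x; rewrite [RHS]hat_emb_base.
- exact: (oe_galois Hdiv eP sc).2.
- split=> [s t|]; last exact: bij_comp (res_bij Hdiv eP sc).
  by rewrite /= (resM sc) gM.
move=> s; have sM := gal_morph s.
have aM := gal_morph (alpha (hat i gamma s)).
apply: (oe_eq Hdiv eP scL (g := s \o sol_emb (hat i gamma))
  (g' := sol_emb (hat i gamma) \o alpha (hat i gamma s))) => [||x|c].
- exact: rm_comp.
- exact: rm_comp.
- rewrite -[LHS]/(s (sol_emb (hat i gamma) (i x))).
  rewrite -[RHS]/(sol_emb (hat i gamma) (alpha (hat i gamma s) (i x))).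
  by rewrite gal_fix hat_emb_base (gal_fix s).
rewrite -[LHS]/(s (sol_emb (hat i gamma) (centre_val c))).
rewrite -[RHS]/(sol_emb (hat i gamma) (alpha (gamma (res (tens_inr k) s)) _)).
by rewrite check_problemE !hat_emb_centre (resE sc) gR.
Qed.

End Hat.

Lemma hat_identifies (f f' : comPzRingType)
    (gamma : solution_data (centre H) (centre L) f G)
    (gamma' : solution_data (centre H) (centre L) f' G) (u : f -> f') :
  solution (check_problem alpha) gamma ->
  only_trivial_zero (sol_base gamma) FH ->
  solution (check_problem alpha) gamma' ->
  only_trivial_zero (sol_base gamma') FH ->
  identifies gamma gamma' u ->
  identifies (hat i gamma) (hat i gamma')
    (tens_map (sol_base gamma) (sol_base gamma') u).
Proof.
move=> gP triv gP' triv' [uM uB uk uv ug].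
have sc := hat_outer gP triv; have sc' := hat_outer gP' triv'.
have TM := tens_map_morphism uM uk.
split.
- exact: TM.
- exact: tens_map_bij.
- by move=> x; rewrite /= tens_map_inl.
- apply: (oe_eq Hdiv eP scL) => [||x|c].
  + exact: rm_comp (hat_embM gP) TM.
  + exact: hat_embM.
  + rewrite -[LHS]/(tens_map _ _ u (sol_emb (hat i gamma) (i x))).
    by rewrite !hat_emb_base // tens_map_inl.
  rewrite -[LHS]/(tens_map _ _ u (sol_emb (hat i gamma) (centre_val c))).
  by rewrite !hat_emb_centre // tens_map_inr // -uv.
move=> s t st; apply: ug => a; apply: (oe_iota_inj sc').
rewrite -(resE sc') -(tens_map_inr uM uk).
by rewrite -(resE sc) -(tens_map_inr uM uk) st.
Qed.

Lemma hat_check (F : pzRingType) (beta : solution_data H L F G) :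
  solution alpha beta ->
  identifies (hat i (check beta)) beta (mult_map (sol_base beta)).
Proof.
move=> bP; have sc := solution_outer bP.
have [cP triv] := check_solution bP; have scT := hat_outer cP triv.
have mM := oe_mult_morphism sc; case: (bP) => _ [_ uM ju] _ _ _.
split.
- exact: mM.
- exact: (oe_mult_bij Hdiv eP sc).
- by move=> x; apply: (oe_mult_inl sc).
- apply: (oe_eq Hdiv eP scL) => [||x|c].
  + exact: rm_comp (hat_embM cP) mM.
  + exact: uM.
  + rewrite -[LHS]/(mult_map _ (sol_emb (hat i (check beta)) (i x))).
    by rewrite hat_emb_base // [LHS](oe_mult_inl sc) ju.
  rewrite -[LHS]/(mult_map _ (sol_emb (hat i (check beta)) (centre_val c))).
  by rewrite hat_emb_centre // [LHS](oe_mult_inr sc) sol_embE.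
move=> s t st; rewrite -[RHS](checkE bP).
rewrite -[LHS]/(check beta (res (tens_inr _) s)).
apply: (congr1 (@sol_map _ _ _ _ (check beta))).
apply/esym/(res_unique sc) => c.
rewrite -[in LHS](oe_mult_inr sc) -[LHS]st.
by rewrite (resE scT) [LHS](oe_mult_inr sc).
Qed.

Lemma check_hat (f : comPzRingType)
    (gamma : solution_data (centre H) (centre L) f G) :
  solution (check_problem alpha) gamma ->
  only_trivial_zero (sol_base gamma) FH ->
  identifies gamma (check (hat i gamma))
    (insubd 0 \o tens_inr (sol_base gamma)).
Proof.
move=> gP triv; have sc := hat_outer gP triv; have hP := hat_solution gP triv.
have sch := solution_outer hP; set k := sol_base gamma in sc *.
have rC a : tens_inr k a \in @central (tensor k).
  by apply/centralP => t; apply: tens_inr_central.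
pose u : f -> centre (tensor k) := insubd 0 \o tens_inr k.
have uE a : centre_val (u a) = tens_inr k a by apply: (insubdK 0 (rC a)).
have rM := tens_inr_morphism k.
have uI : injective u.
  by move=> a b uab; apply: (oe_iota_inj sc); rewrite -!uE uab.
split.
- split=> [a b|].
    apply: val_inj.
    by rewrite /= -![val _]/(centre_val (u _)) !uE (rmB rM).
  split=> [|a b]; apply: val_inj.
    by rewrite /= -![val _]/(centre_val (u _)) uE.
  by rewrite /= -![val _]/(centre_val (u _)) !uE (rmM rM).
- apply: inj_surj_bij uI _ => c.
  have [x|a ca] := oe_centralizer sc (z := val c); first exact/esym/centre_valC.
  by exists a; apply: val_inj; rewrite ca; apply: uE.
- move=> c; apply: val_inj; rewrite -[LHS]/(centre_val (u _)) uE.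
  by rewrite (oe_balanced sc); apply/esym; exact: (oe_balanced sch).
- move=> c; apply: val_inj; rewrite -[LHS]/(centre_val (u _)) uE.
  by rewrite -[RHS]/(centre_val _) sol_embE // hat_emb_centre.
have [r _ Kr] := res_bij Hdiv eP sch.
move=> s t; rewrite -(Kr t) checkE // => st; apply: (congr1 (@sol_map _ _ _ _ gamma)).
apply/esym/(res_unique sc) => a.
by rewrite -!uE (resE sch) -st.
Qed.

End Correspondence.

Theorem mainTheorem4 (H : nzRingType) (n : nat) (e : 'I_(n ^ 2) -> H)
    (FH : {mpoly (centre H)[n ^ 2]}) (L : pzRingType) (i : H -> L)
    (G : finGroupType) (alpha : G -> gal i) :
  division_ring H -> centre_basis e -> reduced_norm_form e FH ->
  embedding_problem alpha ->
  let A (F : pzRingType) (beta : solution_data H L F G) :=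
    solution alpha beta in
  let B (f : comPzRingType) (gamma : solution_data (centre H) (centre L) f G) :=
    solution (check_problem alpha) gamma /\
    only_trivial_zero (sol_base gamma) FH in
  [/\ embedding_problem (check_problem alpha),
      (* beta |-> check beta is well defined *)
      (forall (F : pzRingType) (beta : solution_data H L F G), A F beta ->
         B (centre F) (check beta)) /\
      (forall (F F' : pzRingType) (beta : solution_data H L F G)
          (beta' : solution_data H L F' G) (u : F -> F'),
         A F beta -> A F' beta' -> identifies beta beta' u ->
         identifies (check beta) (check beta') (centre_map u)),
      (* gamma |-> hat gamma is well defined *)
      (forall (f : comPzRingType) (gamma : solution_data (centre H) (centre L) f G), B f gamma ->
         A _ (hat i gamma)) /\
      (forall (f f' : comPzRingType) (gamma : solution_data (centre H) (centre L) f G)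
          (gamma' : solution_data (centre H) (centre L) f' G) (u : f -> f'),
         B f gamma -> B f' gamma' -> identifies gamma gamma' u ->
         identifies (hat i gamma) (hat i gamma')
           (tens_map (sol_base gamma) (sol_base gamma') u)),
      (* hat (check beta) is beta, the tensor product being identified
         with F by multiplication *)
      (forall (F : pzRingType) (beta : solution_data H L F G), A F beta ->
         identifies (hat i (check beta)) beta
           (mult_map (sol_base beta)))
    & (* check (hat gamma) is gamma, f being identified with the centre by a |-> 1 (x) a *)
      (forall (f : comPzRingType) (gamma : solution_data (centre H) (centre L) f G), B f gamma ->
         identifies gamma (check (hat i gamma))
           (insubd 0%R \o tens_inr (sol_base gamma)))].
Proof.
move=> Hdiv eP FHP alphaP A B; split.
- exact: (check_problem_embedding Hdiv eP).
- split; first exact: (check_solution Hdiv eP FHP alphaP).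
  exact: (check_identifies Hdiv eP).
- split=> [f gamma []|]; first exact: (hat_solution Hdiv eP FHP alphaP).
  move=> f f' gamma gamma' u [gP triv] [gP' triv'].
  exact: (hat_identifies Hdiv eP FHP alphaP).
- exact: (hat_check Hdiv eP FHP alphaP).
by move=> f gamma [gP triv]; exact: (check_hat Hdiv eP FHP alphaP).
Qed.
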